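(* Let $G=(V,E,\omega)$ be an undirected $n$-vertex graph with edge weights $\omega(e)\in[1,W]$, let $f\ge 1$ be a bound on the number of edge faults and let $k\ge 1$ be an integer stretch parameter. There is a randomized $f$-fault-tolerant approximate distance labeling scheme for $G$ with label length $O(k\cdot n^{1/k}\cdot \log(nW)\cdot \log^3 n)$ bits such that, given the labels of vertices $s,t$ and of a set $F\subseteq E$ of at most $f$ edges, the decoder returns a distance estimate $\delta(s,t,F)$ satisfying $$\mathrm{dist}_{G\setminus F}(s,t)\le \delta(s,t,F)\le (8k-2)(|F|+1)\,\mathrm{dist}_{G\setminus F}(s,t).$$
   Context: An $f$-fault-tolerant approximate distance labeling scheme assigns to every vertex and every edge of $G$ a bit-string label (the labeling function), together with a decoding function that, given only the labels of two vertices $s,t$ and the labels of the edges of a set $F\subseteq E$ with $|F|\le f$, outputs an estimate $\delta(s,t,F)$ of the weighted shortest-path distance $\mathrm{dist}_{G\setminus F}(s,t)$ (which is $\infty$ if $s,t$ are disconnected in $G\setminus F$). The label length is the maximum number of bits of any label. ''Randomized'' means the labels are computed by a randomized algorithm, and for every fixed query triplet $\langle s,t,F\rangle$ the output is correct with high probability, i.e., with probability at least $1-1/n^c$ for any desired constant $c$. *)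

(* Defs.v *)
From mathcomp Require Import all_boot all_order all_algebra.
From mathcomp Require Import all_classical all_reals all_analysis.

Set Implicit Arguments.
Unset Strict Implicit.
Unset Printing Implicit Defensive.

Import Order.TTheory GRing.Theory Num.Theory.
Local Open Scope ring_scope.

(* Simple undirected weighted graph: an edge is a two-element set of vertices.
   The values of [weight] outside [edges] are irrelevant. *)
Record wgraph (R : realType) (V : finType) := WGraph {
  edges : {set {set V}};
  edges_card2 : forall e, e \in edges -> #|e| = 2%N;
  weight : {set V} -> R
}.

Section Distance.
Variables (R : realType) (V : finType) (G : wgraph R V).

Definition adj_minus (F : {set {set V}}) : rel V :=
  [rel u v | [set u; v] \in edges G :\: F].

Fixpoint walk_weight (s : V) (p : seq V) : R :=
  if p is v :: p' then weight G [set s; v]%SET + walk_weight v p' else 0.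

(* The walk s :: p, from s to t in G \ F. *)
Definition is_walk (F : {set {set V}}) (s t : V) (p : seq V) : Prop :=
  path (adj_minus F) s p /\ last s p = t.

(* The infimum of the empty set is +oo, the distance when s and t are
   disconnected in G \ F. *)
Definition dist (F : {set {set V}}) (s t : V) : \bar R :=
  ereal_inf [set (walk_weight s p)%:E | p in is_walk F s t]%classic.

End Distance.

(* Only the labels of the edges of the graph at hand are meaningful. *)
Record labeling (V : finType) := Labeling {
  vlabel : V -> bitseq;
  elabel : {set V} -> bitseq
}.

Definition label_length (R : realType) (V : finType) (G : wgraph R V)
    (L : labeling V) : nat :=
  maxn (\max_(v : V) size (vlabel L v)) (\max_(e in edges G) size (elabel L e)).

(* A decoder sees nothing but the labels of s, of t and of the failed edges. *)
Definition decoder (R : realType) := bitseq -> bitseq -> seq bitseq -> \bar R.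

(* Labels of bounded length on a fixed finite graph form a finite set, so the
   output of a randomized labeling algorithm is described by a finite
   probability space. *)
Record fin_prob (R : realType) (Omega : finType) := FinProb {
  pmf : Omega -> R;
  pmf_ge0 : forall x, 0 <= pmf x;
  pmf_sum1 : \sum_x pmf x = 1
}.

Definition Prob (R : realType) (Omega : finType) (P : fin_prob R Omega)
    (A : pred Omega) : R :=
  \sum_(x | A x) pmf P x.

Definition good_estimate (R : realType) (V : finType) (G : wgraph R V)
    (stretch : nat -> R) (s t : V) (F : {set {set V}}) (delta : \bar R) : bool :=
  (dist G F s t <= delta <= (stretch #|F|)%:E * dist G F s t)%E.

(* [dec] decodes a randomized f-fault-tolerant approximate distance labeling of
   G: every label, for every outcome of the randomness, has at most [len] bits,
   and every fixed query is answered within the stretch (a function of |F|) with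
   probability at least 1 - err.  The set F reaches the decoder as an arbitrary
   duplicate-free listing, so that no information is carried by the order. *)
Definition randomized_FT_distance_labeling (R : realType) (V : finType)
    (G : wgraph R V) (dec : decoder R) (f : nat) (stretch : nat -> R)
    (len err : R) : Prop :=
  exists (Omega : finType) (P : fin_prob R Omega) (L : Omega -> labeling V),
    (forall x, (label_length G (L x))%:R <= len) /\
    (forall (s t : V) (F : {set {set V}}) (Fs : seq {set V}),
      F \subset edges G -> (#|F| <= f)%N -> perm_eq Fs (enum F) ->
      Prob P (fun x =>
        good_estimate G stretch s t F
          (dec (vlabel (L x) s) (vlabel (L x) t) (map (elabel (L x)) Fs)))
      >= 1 - err).

(* Main.v *)
Require Import Defs.
From mathcomp Require Import all_boot all_order all_algebra all_field.
From mathcomp Require Import all_classical all_reals all_analysis.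
From mathcomp Require Import zify lra ring fintype finset.

Set Implicit Arguments.
Unset Strict Implicit.
Unset Printing Implicit Defensive.

Import Order.TTheory GRing.Theory Num.Theory.
Local Open Scope ring_scope.

(** For every scale 2^i an Awerbuch-Peleg cover is computed in at most k n^(1/k)
    phases; the clusters of a phase are disjoint, and every ball of radius 2^i
    lies in a cluster of some phase.  The edges of weight at most 2^i inside the
    clusters of a phase form a graph with a spanning forest of depth at most
    (2k-1) 2^i.  If s and t are connected in it after removing F, then the forest
    minus F has at most |F|+1 components in their cluster, so their distance in
    G \ F is at most (4k-1)(|F|+1) 2^i.  The decoder returns this bound for the
    first scale at which some phase connects s and t.

    Connectivity under faults is decoded from linear graph sketches.  In a DFS
    order every subtree is an interval, and a union of components of forest \ F
    is a symmetric difference of the intervals stored at F and of the cluster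
    interval; summing the sketches stored at F, in characteristic 2, gives a
    random sketch of the surviving edges leaving that union.  A fresh sketch
    isolates one such edge with probability at least 1/8, hence O(log n) Boruvka
    rounds merge everything that is connected.  The edge {u, v} is represented by
    x^(un+v) + x^(vn+u) for a random field element x stored in the labels: a sum
    of several edges is mistaken for a single edge only if x is a root of a fixed
    nonzero polynomial.

    Only the scales i with w(e) <= 2^i < 2 n w(e) for some edge e are used, which
    keeps the union bound over the scales polynomial in n, independently of W. *)

(** * Bit strings *)

Section Encoding.
Local Open Scope nat_scope.

(** The delicate point is adaptivity: which cuts are examined in a round depends on what earlier
    rounds found, hence on the randomness. The analysis therefore follows an ideal run
    ([ideal_step]) that sees the isolated edges themselves. It depends on the samples only, and each
    round meets a sample independent of the current blocks, so the number of unfinished blocks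
    shrinks by a factor 15/16 on average. Once the samples are fixed, so are the cuts of the ideal
    run, and only polynomially many values of the independent field element x make the decoder
    deviate from it. Probabilities are handled as cardinalities of finite sets of outcomes.

    The labels cannot know F. The balls are taken in the fault-free graph, so the ball around s
    contains every light enough walk from s, whatever F it avoids.

    The factor 4k-1 is 2(2k-1)+1: a climb and a descent in the forest plus one crossing edge.
    Rounding the distance up to a power of 2 doubles it to 8k-2. In the label length, k n^(1/k)
    counts phases, log(nW) counts scales, and the three factors log n are the rounds, the levels and
    the bits of a field element. *)

Fixpoint bits (f n : nat) : bitseq :=
  if f is f'.+1 then odd n :: bits f' n./2 else [::].

Fixpoint nat_of_bits (s : bitseq) : nat :=
  if s is b :: s' then b + (nat_of_bits s').*2 else 0.

Lemma size_bits f n : size (bits f n) = f.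
Proof. by elim: f n => //= f IH n; rewrite IH. Qed.

Lemma bitsK f n : n < 2 ^ f -> nat_of_bits (bits f n) = n.
Proof.
elim: f n => [|f IH] n /=; first by rewrite expn0; case: n.
rewrite expnS => lt_n; rewrite IH; last by rewrite ltn_half_double -mul2n.
exact: odd_double_half.
Qed.

(** A self-delimiting code: words can be recovered from their concatenation, at a constant factor in
    length even when the code is nested. *)
Fixpoint enc_word (w : bitseq) : bitseq :=
  if w is b :: w' then [:: true, b & enc_word w'] else [:: false].

Definition enc_seq (ss : seq bitseq) : bitseq := flatten (map enc_word ss).

Fixpoint parse_from (cur s : bitseq) : seq bitseq :=
  match s with
  | true :: b :: s' => parse_from (rcons cur b) s'
  | false :: s' => cur :: parse_from [::] s'
  | _ => [::]
  end.

Definition parse := parse_from [::].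

Lemma enc_seqK : cancel enc_seq parse.
Proof.
have parse_word w cur s :
    parse_from cur (enc_word w ++ s) = (cur ++ w) :: parse s.
  by elim: w cur => [|b w IH] cur /=; rewrite ?cats0 // IH cat_rcons.
by elim=> [|w ss IH] //; rewrite /enc_seq /= /parse parse_word IH.
Qed.

Lemma size_enc_word w : size (enc_word w) = (2 * size w).+1.
Proof. by elim: w => //= b w ->; lia. Qed.

Lemma size_enc_seq_cons w ss :
  size (enc_seq (w :: ss)) = (2 * size w).+1 + size (enc_seq ss).
Proof. by rewrite /enc_seq /= size_cat size_enc_word. Qed.

Lemma size_enc_seq_le (B : nat) ss :
  (forall w, w \in ss -> size w <= B) ->
  size (enc_seq ss) <= size ss * (2 * B).+1.
Proof.
elim: ss => [|w ss IH] // leB; rewrite size_enc_seq_cons /= (mulSn (size ss)).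
apply: leq_add; first by rewrite ltnS leq_mul2l /= leB ?mem_head.
by apply: IH => v v_ss; apply: leB; rewrite inE v_ss orbT.
Qed.

Definition code (T : finType) (B : nat) (x : T) : bitseq :=
  bits B (enum_rank x).

Definition decode (T : finType) (B : nat) (s : bitseq) : option T :=
  [pick x | code B x == s].

Lemma code_inj (T : finType) B : #|T| <= 2 ^ B -> injective (@code T B).
Proof.
move=> leT x y /(congr1 nat_of_bits).
rewrite !bitsK ?(leq_trans (ltn_ord _) leT) // => /val_inj.
exact: enum_rank_inj.
Qed.

Lemma codeK (T : finType) B (x : T) :
  #|T| <= 2 ^ B -> decode T B (code B x) = Some x.
Proof.
move=> leT; rewrite /decode; case: pickP => [y /eqP /(code_inj leT) -> //|].
by move/(_ x); rewrite eqxx.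
Qed.

End Encoding.

(** * Isolating a random cut edge *)

Section Isolation.
Local Open Scope nat_scope.

Lemma card_ord_lt (Q q : nat) : q <= Q -> #|[pred i : 'I_Q | i < q]| = q.
Proof.
move=> leqQ; rewrite -sum1_card /=.
under eq_bigl do rewrite inE.
by rewrite -(big_ord_widen Q (fun=> 1) leqQ) sum1_card card_ord.
Qed.

Lemma card_ord_ge (Q q : nat) : q <= Q -> #|[pred i : 'I_Q | q <= i]| = Q - q.
Proof.
move=> leqQ; rewrite -[in RHS](card_ord Q) -(cardC [pred i : 'I_Q | i < q]).
rewrite card_ord_lt // addKn; apply: eq_card => i.
by rewrite !inE -leqNgt.
Qed.

(** Cleared of denominators: e alone survives with probability (q/Q)(1 - q/Q)^(|A|-1). The event is
    a product, with one range of values for each coordinate. *)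
Lemma card_unique_sample (E : finType) (Q q : nat) (A : {set E}) (e : E) :
  q <= Q -> e \in A ->
  #|[set w : {ffun E -> 'I_Q} | [set x in A | w x < q] == [set e]]| * Q ^ #|A|
  = q * (Q - q) ^ #|A|.-1 * Q ^ #|E|.
Proof.
move=> leqQ eA.
pose G x := [pred i : 'I_Q |
  if x == e then i < q else if x \in A then q <= i else true].
have -> : #|[set w : {ffun E -> 'I_Q} | [set x in A | w x < q] == [set e]]| =
          #|family G|.
  apply: eq_card => w; rewrite inE; apply/eqP/familyP => [/setP sA x|Gw].
    have := sA x; rewrite !inE; case: eqP => [-> |_]; rewrite ?eqxx ?eA //=.
    by case: (x \in A) => //= /negbT; rewrite -leqNgt.
  apply/setP=> x; have := Gw x; rewrite !inE; case: eqP => [-> ->|_].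
    by rewrite eA.
  by case: (x \in A) => //=; rewrite ltnNge => ->.
rewrite card_family foldrE big_map big_enum /= (bigD1 e) //=.
have -> : #|G e| = q.
  by rewrite -[RHS](card_ord_lt leqQ); apply: eq_card => i; rewrite !inE eqxx.
rewrite (bigID (mem A)) /=.
rewrite (eq_bigr (fun=> Q - q)); last first.
  move=> x /andP[/negbTE nxe xA]; rewrite -[RHS](card_ord_ge leqQ).
  by apply: eq_card => i; rewrite !inE nxe xA.
rewrite [X in _ * (_ * X) * _](eq_bigr (fun=> Q)); last first.
  move=> x /andP[/negbTE nxe /negbTE xA]; rewrite -[RHS](card_ord Q).
  by apply: eq_card => i; rewrite !inE nxe xA.
rewrite !prod_nat_const.
have -> : #|[pred x | (x != e) && (x \in A)]| = #|A|.-1.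
  by rewrite (cardsD1 e A) eA /=; apply: eq_card => x; rewrite !inE.
have <- : #|[pred x | (x != e) && (x \notin A)]| + #|A| = #|E|.
  rewrite addnC -(cardC (mem A)); congr (_ + _); apply: eq_card => x.
  by rewrite !inE; case: eqP => // ->; rewrite eA.
by rewrite expnD !mulnA.
Qed.

(** Bernoulli's inequality (1 - q/Q)^a >= 1 - a q/Q multiplied by Q^(a+1); if a q > Q, the truncated
    left side is 0. *)
Lemma bernoulli_nat (Q q a : nat) : q <= Q ->
  Q ^ a * (Q - a * q) <= Q * (Q - q) ^ a.
Proof.
move=> leqQ; elim: a => [|a IH]; first by rewrite mul0n subn0 !expn0 mul1n muln1.
rewrite !expnS; move: IH; set X := Q ^ a; set Y := (Q - q) ^ a => IH.
have h : Q * (Q - a.+1 * q) <= (Q - a * q) * (Q - q).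
  have [le1|/ltnW gt1] := leqP (a.+1 * q) Q; last by rewrite (eqP gt1) muln0.
  have [d ->] : exists d, Q = a.+1 * q + d by exists (Q - a.+1 * q); rewrite subnKC.
  have -> : a.+1 * q + d - a * q = q + d by rewrite mulSn; lia.
  have -> : a.+1 * q + d - q = a * q + d by rewrite mulSn; lia.
  by rewrite addKn mulSn; nia.
rewrite mulnAC mulnA [X in _ <= X]mulnAC; apply: leq_trans (leq_mul IH (leqnn _)).
by rewrite mulnC -mulnA leq_mul2l h orbT.
Qed.

(* Sampling with probability 2^-j, where 1/4 <= |A| 2^-j <= 1/2, leaves a unique
   element of A with probability at least 1/8. *)
Lemma isolation (E : finType) (M : nat) (A : {set E}) :
  A != set0 -> #|A| < 2 ^ M.-1 ->
  #|{ffun E -> 'I_(2 ^ M)}| <=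
  8 * #|[set w : {ffun E -> 'I_(2 ^ M)} |
         [exists l : 'I_M, exists e, [set x in A | w x < 2 ^ l] == [set e]]]|.
Proof.
move=> A0 ltA; set a := #|A|; have a_gt0 : 0 < a by rewrite card_gt0.
pose t := trunc_log 2 a.
have /andP[tlo thi] : 2 ^ t <= a < 2 ^ t.+1 by exact: trunc_log_bounds.
have ltM : t.+1 < M.
  have : t < M.-1 by rewrite -(@ltn_exp2l 2) // (leq_ltn_trans tlo).
  by lia.
have lM : M - t.+2 < M by lia.
pose q := 2 ^ (M - t.+2).
have QE : 2 ^ M = 4 * (2 ^ t * q).
  by rewrite -[4]/(2 ^ 2) /q -!expnD; congr (_ ^ _); lia.
set Q := 2 ^ M in QE *.
have Q0 : 0 < Q by rewrite expn_gt0.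
have Q4 : Q <= 4 * (a * q) by rewrite QE leq_mul2l leq_mul2r tlo orbT.
have Q2 : 2 * (a * q) <= Q.
  by rewrite QE; move: thi; rewrite expnS; nia.
have leqQ : q <= Q by nia.
set S := [set w | _].
pose T e := [set w : {ffun E -> 'I_Q} | [set x in A | w x < q] == [set e]].
(* The events [T e] are disjoint, since a sample determines the surviving set, so their sizes add up
   inside [S]. *)
have leS : \sum_(e in A) #|T e| <= #|S|.
  rewrite -sum1_card; under eq_bigr do rewrite -sum1_card.
  rewrite (exchange_big_dep (mem S)) /=; last first.
    move=> e w eA; rewrite !inE => /eqP we; apply/existsP.
    by exists (Ordinal lM); apply/existsP; exists e; apply/eqP.
  apply: leq_sum => w _; rewrite sum1_card; apply/card_le1_eqP => e e'.
  by move=> /andP[_] + /andP[_]; rewrite !inE => /eqP -> /eqP /set1_inj ->.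
(* The 1/8 is a product: a q/Q >= 1/4 by [Q4], and (1 - q/Q)^(a-1) >= 1/2 by Bernoulli and [Q2]. The
   factor [Q ^ a * Q] clears the denominators. *)
have main : #|{ffun E -> 'I_Q}| * (Q ^ a * Q) <= 8 * #|S| * (Q ^ a * Q).
  apply: leq_trans (leq_mul (leq_mul (leqnn 8) leS) (leqnn _)).
  rewrite mulnA -[8 * _ * _]mulnA big_distrl /=.
  rewrite (eq_bigr (fun=> q * (Q - q) ^ a.-1 * Q ^ #|E| * Q)); last first.
    by move=> e eA; rewrite mulnA card_unique_sample.
  rewrite sum_nat_const -/a card_ffun card_ord.
  have := bernoulli_nat a.-1 leqQ.
  set Y := (Q - q) ^ _; set Z := Q ^ #|E|; move=> bern.
  have -> : Q ^ a = Q * Q ^ a.-1 by rewrite -expnS prednK.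
  set W := Q ^ a.-1 in bern *.
  have h1 : Q <= 2 * (Q - a.-1 * q) by nia.
  have h2 : W * Q <= 2 * (Q * Y) by nia.
  rewrite -mulnA [X in _ <= X](_ : _ = Z * ((4 * (a * q)) * (2 * (Q * Y)))); last by ring.
  rewrite leq_mul2l; apply/orP; right.
  rewrite [Q * W]mulnC [W * Q * Q]mulnC.
  exact: leq_mul.
by move: main; rewrite leq_pmul2r // muln_gt0 Q0 expn_gt0 Q0.
Qed.

End Isolation.

(** * Boruvka rounds with isolated cut edges *)

Section Boruvka.
Local Open Scope nat_scope.
Variables (U E : finType) (M : nat) (base H : rel U) (K : {set U}).
Variable nm : U * U -> E.

Notation smp := {ffun E -> 'I_(2 ^ M)}.

Definition link (m : {set U * U}) : rel U :=
  [rel u v | [|| base u v, (u, v) \in m | (v, u) \in m]].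

Definition block (m : {set U * U}) (w : U) : {set U} :=
  [set v | connect (link m) w v].

Definition edge_cut (B : {set U}) : {set U * U} :=
  [set xy | [&& xy.1 \in B, xy.2 \notin B & H xy.1 xy.2]].

Definition sampled_cut (w : smp) (l : nat) (B : {set U}) : {set U * U} :=
  [set xy in edge_cut B | w (nm xy) < 2 ^ l].

Definition isolates (w : smp) (B : {set U}) (uv : U * U) : bool :=
  [exists l : 'I_M, sampled_cut w l B == [set uv]].

(** What an error-free decoder would do: it reads the isolated edges off the sample and involves no
    fingerprint. *)
Definition ideal_step (m : {set U * U}) (w : smp) : {set U * U} :=
  m :|: [set uv | [exists x in K, isolates w (block m x) uv]].

Definition alive (m : {set U * U}) : {set {set U}} :=
  [set B in block m @: K | edge_cut B != set0].

Definition sound (m : {set U * U}) : Prop :=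
  forall uv, uv \in m -> (uv.1 \in K) && H uv.1 uv.2.

Hypothesis base_sym : symmetric base.
Hypothesis base_K : forall u v, base u v -> (u \in K) = (v \in K).
Hypothesis base_conn : forall u v, u \in K -> base u v -> connect H u v.
Hypothesis H_sym : symmetric H.
Hypothesis H_K : forall u v, H u v -> (u \in K) = (v \in K).
Hypothesis nm_cut : forall B : {set U}, {in edge_cut B &, injective nm}.
Hypothesis card_U : #|U| * #|U| < 2 ^ M.-1.

Lemma link_sym m : symmetric (link m).
Proof. by move=> u v; rewrite /link /= base_sym [((u, v) \in m) || _]orbC. Qed.

Lemma connect_link_sym m : connect_sym (link m).
Proof. exact/sym_connect_sym/link_sym. Qed.

Lemma block_refl m w : w \in block m w.
Proof. by rewrite inE connect0. Qed.

Lemma block_eq m u v : v \in block m u -> block m v = block m u.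
Proof.
rewrite inE => uv; apply/setP=> x; rewrite !inE.
by rewrite (same_connect (connect_link_sym m) uv).
Qed.

Lemma link_K m u v : sound m -> link m u v -> (u \in K) = (v \in K).
Proof.
move=> sm /or3P[/base_K //|/sm/andP[_ /H_K //]|/sm/andP[_ /H_K //]].
Qed.

Lemma link_connect m u v : sound m -> u \in K -> link m u v -> connect H u v.
Proof.
move=> sm uK /or3P[/(base_conn uK) //|/sm/andP[_ /= h]|/sm/andP[_ /= h]].
  exact: connect1.
by apply: connect1; rewrite H_sym.
Qed.

Lemma connect_link_K m u v : sound m -> connect (link m) u v ->
  (u \in K) = (v \in K).
Proof.
move=> sm /connectP[p + ->]; elim: p u => //= x p IH u /andP[ux /IH <-].
exact: link_K ux.
Qed.

Lemma block_connect m u v : sound m -> u \in K -> v \in block m u ->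
  connect H u v.
Proof.
move=> sm uK; rewrite inE => /connectP[p + ->].
elim: p u uK => //= x p IH u uK /andP[ux px].
apply: connect_trans (link_connect sm uK ux) _.
by apply: IH px; rewrite -(link_K sm ux).
Qed.

Lemma sound_ideal_step m w : sound m -> sound (ideal_step m w).
Proof.
move=> sm [u v]; rewrite !inE => /orP[/sm //|/existsP[x /andP[xK]]].
case/existsP=> l /eqP Duv.
have : (u, v) \in sampled_cut w l (block m x) by rewrite Duv inE.
rewrite !inE /= => /andP[/and3P[ux _ Huv] _]; rewrite Huv andbT.
by rewrite -(connect_link_K sm ux).
Qed.

Lemma block_K m w : sound m -> w \in K -> block m w \subset K.
Proof.
by move=> sm wK; apply/subsetP=> v; rewrite inE => /(connect_link_K sm) <-.
Qed.

(** If no block is alive, no edge of [H] leaves the block of u, so a walk from u stays in it. *)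
Lemma block_complete m u v : sound m -> u \in K -> alive m = set0 ->
  (v \in block m u) = connect H u v.
Proof.
move=> sm uK al0; apply/idP/idP; first exact: block_connect.
case/connectP=> p + ->; elim/last_ind: p => [|p x IH]; first by rewrite block_refl.
rewrite rcons_path last_rcons => /andP[/IH lB Hx].
have : block m u \notin alive m by rewrite al0 inE.
rewrite inE (imset_f (block m)) //= negbK => /eqP cut0.
have : (last u p, x) \notin edge_cut (block m u) by rewrite cut0 inE.
by rewrite inE /= lB Hx andbT negbK.
Qed.

Lemma sub_link m w : subrel (link m) (link (ideal_step m w)).
Proof.
by move=> u v; rewrite /link /= ![(_, _) \in _]inE => /or3P[]->; rewrite ?orbT.
Qed.

Lemma sub_block m w u : block m u \subset block (ideal_step m w) u.
Proof.
apply/subsetP=> v; rewrite !inE; apply: connect_sub => x y xy.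
exact/connect1/sub_link.
Qed.

Definition success (w : smp) (B : {set U}) : bool := [exists uv, isolates w B uv].

(* A new alive block contains an old alive block without success, or two
   different old alive blocks. *)
Lemma alive_ideal_step m w : sound m ->
  2 * #|alive (ideal_step m w)| <= \sum_(B in alive m) (2 - success w B).
Proof.
move=> sm; set m' := ideal_step m w.
have sm' : sound m' by exact: sound_ideal_step.
pose up (B : {set U}) := [set v | [exists x in B, connect (link m') x v]].
have upE x : up (block m x) = block m' x.
  apply/setP=> v; rewrite !inE; apply/existsP/idP => [[y /andP[xy yv]]|xv].
    apply: connect_trans yv; have := subsetP (sub_block m w x) y xy.
    by rewrite inE.
  by exists x; rewrite block_refl.
apply: (@leq_trans (\sum_(B in alive m | up B \in alive m') (2 - success w B)));
  last by rewrite [X in _ <= X](bigID (fun B => up B \in alive m')) leq_addr.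
rewrite (partition_big up (mem (alive m'))) /=; last by move=> B /andP[].
rewrite mulnC -sum_nat_const; apply: leq_sum => B'.
rewrite inE => /andP[/imsetP[x0 x0K defB'] /set0Pn[[u v]]].
rewrite inE /= => /and3P[uB' vB' Huv].
have B'u : B' = block m' u by rewrite defB' (@block_eq _ x0 u) // -defB'.
have uK : u \in K by apply: subsetP (block_K sm' x0K) _ _; rewrite -defB'.
have B'al : B' \in alive m'.
  rewrite inE defB' imset_f //=; apply/set0Pn; exists (u, v).
  by rewrite inE /= -defB' uB' vB'.
have cutu : (u, v) \in edge_cut (block m u).
  rewrite inE /= block_refl Huv andbT /=; apply: contra vB' => vB.
  by rewrite B'u (subsetP (sub_block m w u)).
have alu : block m u \in alive m.
  by rewrite inE imset_f //=; apply/set0Pn; exists (u, v).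
rewrite (bigD1 (block m u)) /=; last by rewrite alu upE -B'u B'al eqxx.
case suc: (success w (block m u)); last by rewrite subn0 leq_addr.
have /existsP[[x y] isoxy] := suc.
have /existsP[l /eqP Dxy] := isoxy.
have : (x, y) \in sampled_cut w l (block m u) by rewrite Dxy inE.
rewrite ![(_, _) \in _]inE /= => /andP[/and3P[xB yB Hxy] _].
have xy' : link m' x y.
  rewrite /link /= ![(_, _) \in _]inE; apply/or3P; apply: Or32.
  by apply/orP; right; apply/existsP; exists u; rewrite uK.
have B'x : block m' x = B'.
  by rewrite B'u; apply: block_eq; apply: subsetP (sub_block m w u) _ _.
have B'y : block m' y = B'.
  by rewrite -B'x; apply: block_eq; rewrite inE connect1.
have xK : x \in K by apply: subsetP (block_K sm uK) _ _.
have yK : y \in K by rewrite -(H_K Hxy).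
have neq : block m y != block m u.
  by apply: contraNneq yB => <-; rewrite block_refl.
(* The reversed edge leaves the block of y, which is thus a second old alive block inside [B'] and
   contributes at least 1. *)
have aly : block m y \in alive m.
  rewrite inE imset_f //=; apply/set0Pn; exists (y, x).
  rewrite inE /= block_refl H_sym Hxy andbT /=; apply: contra neq => xBy.
  by rewrite -(block_eq xBy) (block_eq xB).
rewrite (bigD1 (block m y)) /=; last first.
  by rewrite aly upE B'y B'al eqxx.
by rewrite addnA (leq_trans _ (leq_addr _ _)) //; case: (success _ (block m y)).
Qed.

(** Isolation concerns edge names. It transfers to oriented pairs because a cut contains each name
    only once. *)
Lemma success_often m B : B \in alive m ->
  #|{: smp}| <= 8 * \sum_(w : smp) success w B.
Proof.
rewrite inE => /andP[_ cut0].
have A0 : nm @: edge_cut B != set0.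
  by have /set0Pn[xy xyB] := cut0; apply/set0Pn; exists (nm xy); exact: imset_f.
have ltA : #|nm @: edge_cut B| < 2 ^ M.-1.
  apply: leq_ltn_trans card_U; apply: leq_trans (leq_imset_card _ _) _.
  by rewrite -card_prod max_card.
apply: leq_trans (isolation A0 ltA) _; rewrite leq_mul2l /= -sum1_card.
rewrite big_mkcond /=; apply: leq_sum => w _; rewrite inE.
case: ifP => // /existsP[l /existsP[e /eqP De]].
have : e \in [set x in nm @: edge_cut B | w x < 2 ^ l] by rewrite De inE.
rewrite inE => /andP[/imsetP[uv uvB eE] we].
rewrite lt0b; apply/existsP; exists uv; apply/existsP; exists l.
apply/eqP/setP=> xy; rewrite in_set1 in_set; apply/andP/eqP => [[xyB wxy]|->].
  apply: (nm_cut xyB uvB); apply/set1P; rewrite -eE -De inE wxy andbT.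
  exact: imset_f.
by rewrite -eE.
Qed.

(** On average a block contributes at most 2 - 1/8 to the bound of [alive_ideal_step]; halving gives
    15/16. *)
Lemma alive_decay m : sound m ->
  16 * \sum_(w : smp) #|alive (ideal_step m w)| <= 15 * #|{: smp}| * #|alive m|.
Proof.
move=> sm; rewrite -[16]/(8 * 2) -mulnA big_distrr /=.
apply: (@leq_trans (8 * \sum_(w : smp) \sum_(B in alive m) (2 - success w B))).
  by rewrite leq_mul2l /=; apply: leq_sum => w _; exact: alive_ideal_step.
rewrite exchange_big /= big_distrr /= [X in _ <= X]mulnC -sum_nat_const.
apply: leq_sum => B /success_often.
have : \sum_(w : smp) (2 - success w B) + \sum_(w : smp) success w B = 2 * #|{: smp}|.
  rewrite -big_split /= (eq_bigr (fun=> 2)) ?sum_nat_const 1?mulnC // => w _.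
  by case: success.
move: (\sum_w _) (\sum_w _) => x y; lia.
Qed.

(** Once the first sample is fixed, the other rounds start from a fixed state with fresh samples, so
    the decay factors multiply. *)
Lemma alive_run L m : sound m ->
  16 ^ L * \sum_(t : L.-tuple smp) #|alive (foldl ideal_step m t)|
  <= 15 ^ L * #|{: smp}| ^ L * #|alive m|.
Proof.
elim: L m => [|L IH] m sm.
  rewrite !expn0 !mul1n (big_pred1 [tuple]) //= => t.
  by apply/esym/eqP; rewrite (tuple0 t).
rewrite (reindex (fun wt : smp * L.-tuple smp => cons_tuple wt.1 wt.2)) /=; last first.
  exists (fun t : L.+1.-tuple smp => (thead t, behead_tuple t)).
    by case=> w t _ /=; congr pair; apply: val_inj.
  by move=> t _ /=; rewrite [t in RHS]tuple_eta; exact: val_inj.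
rewrite -(pair_bigA _ (fun w (t : L.-tuple smp) =>
  #|alive (foldl ideal_step (ideal_step m w) t)|)) /=.
rewrite expnS -mulnA big_distrr /=.
apply: (@leq_trans (16 * \sum_(w : smp)
  15 ^ L * #|{: smp}| ^ L * #|alive (ideal_step m w)|)).
  rewrite leq_mul2l /=; apply: leq_sum => w _; apply: IH.
  exact: sound_ideal_step.
rewrite -big_distrr /= mulnCA !expnS.
apply: leq_trans (leq_mul (leqnn _) (alive_decay sm)) _.
by apply: eq_leq; ring.
Qed.

End Boruvka.

(** * Rooted forests and the sketch decoder *)

Section Forest.
Local Open Scope nat_scope.
Variables (U : finType) (H : rel U).

(** Roots are the fixed points of [par], [rk] excludes cycles of parents, and [edge_rt] makes every
    tree span a whole component of [H]. *)
Record forest (par rt : U -> U) (rk : U -> nat) : Prop := Forest {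
  par_rk : forall u, par u != u -> rk (par u) < rk u;
  par_edge : forall u, par u != u -> H u (par u);
  rt_par : forall u, rt (par u) = rt u;
  rt_root : forall u, par u = u -> rt u = u;
  edge_rt : forall u v, H u v -> rt u = rt v
}.

Definition subtree (par : U -> U) (c : U) : {set U} := [set u | fconnect par u c].

Variables (par rt : U -> U) (rk : U -> nat).
Hypothesis fo : forest par rt rk.

Lemma forest_ind (P : U -> Prop) :
  (forall u, par u = u -> P u) ->
  (forall u, par u != u -> P (par u) -> P u) -> forall u, P u.
Proof.
move=> P0 PS u; have [k] := ubnP (rk u).
elim: k u => // k IH u ltk; have [/P0 //|pu] := eqVneq (par u) u.
apply: PS => //; apply: IH.
exact: leq_trans (par_rk fo pu) ltk.
Qed.

Lemma par_rt u : par (rt u) = rt u.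
Proof.
elim/forest_ind: u => u; first by move=> pu; rewrite (rt_root fo pu).
by move=> _; rewrite (rt_par fo).
Qed.

Lemma subtree_root c u : par u = u -> (u \in subtree par c) = (u == c).
Proof.
move=> pu; rewrite inE; apply/idP/eqP => [|->]; last exact: connect0.
by case/connectP=> p + ->; elim: p u pu => //= x p IH u pu /andP[/eqP <-]; rewrite pu; apply: IH.
Qed.

Lemma subtree_par c u : c != u -> (u \in subtree par c) = (par u \in subtree par c).
Proof. by move=> ne; rewrite inE fconnect_eqVf eq_sym (negbTE ne) inE. Qed.

Lemma subtree_self c : c \in subtree par c.
Proof. by rewrite inE connect0. Qed.

Lemma subtree_rk c u : u \in subtree par c -> u != c -> rk c < rk u.
Proof.
elim/forest_ind: u => u pu; first by rewrite subtree_root // => ->.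
move=> IH + ne; rewrite subtree_par 1?eq_sym // => pc.
have [<-|/(IH pc) lt] := eqVneq (par u) c; first exact: par_rk fo _ pu.
exact: ltn_trans lt (par_rk fo pu).
Qed.

Lemma subtree_rt c u : u \in subtree par c -> rt u = rt c.
Proof.
elim/forest_ind: u => u pu; first by rewrite subtree_root // => /eqP ->.
move=> IH; have [-> //|ne] := eqVneq c u.
by rewrite subtree_par // => /IH <-; rewrite (rt_par fo).
Qed.

Lemma subtree_rtE u v : (u \in subtree par (rt v)) = (rt u == rt v).
Proof.
apply/idP/eqP => [/subtree_rt ->|<-]; first by rewrite (rt_root fo (par_rt v)).
elim/forest_ind: u => u pu; first by rewrite (rt_root fo pu) subtree_self.
rewrite (rt_par fo) => IH; have [->|ne] := eqVneq (rt u) u; last by rewrite subtree_par.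
exact: subtree_self.
Qed.

End Forest.

(* Data stored at a failed edge: its ends, the subtree below it (empty off the forest),
   and, for each round and level, the sum ez of the vertex sketches of that subtree and
   its own sketch ey. *)
Record edge_entry (U : finType) (A : Type) := EdgeEntry {
  eu : U; ev : U; eD : {set U}; ez : nat -> nat -> A; ey : nat -> nat -> A
}.

Section Decoder.
Variables (U : finType) (A : zmodType) (M : nat) (tg : U * U -> A).
Variables (K : {set U}) (es : seq (edge_entry U A)).

(** When [Ds] lists the subtrees below the failed tree edges, the classes of this relation inside
    the tree [K] are the components of the tree without F. The decoder thus knows them without
    knowing the tree. *)
Definition same (Ds : seq {set U}) : rel U :=
  [rel u v | ((u \in K) == (v \in K)) && all (fun D : {set U} => (u \in D) == (v \in D)) Ds].


Lemma same_sym (Ds : seq {set U}) : symmetric (same Ds).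
Proof.
move=> u v; rewrite /same /= eq_sym; congr andb.
by apply: eq_all => D; rewrite eq_sym.
Qed.

Lemma same_K (Ds : seq {set U}) u v : same Ds u v -> (u \in K) = (v \in K).
Proof. by case/andP=> /eqP. Qed.

Definition xorset (Ds : seq {set U}) : {set U} :=
  [set u | odd (count (fun D : {set U} => u \in D) Ds)].

Notation Ds := (map (@eD U A) es).

(** The subtree sketches add up to the whole cut of B, failed edges included; adding the failed
    edges that cross B once more cancels them in characteristic 2. *)
Definition sketch (p l : nat) (ms : bitseq) (B : {set U}) : A :=
  \sum_(e <- mask ms es) ez e p l +
  \sum_(e <- es | (eu e \in B) != (ev e \in B)) ey e p l.

(** The bit [b] complements within [K] and leaves the sketch unchanged, because no edge leaves
    [K]. *)
Definition found (m : {set U * U}) (p : nat) (uv : U * U) : Prop :=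
  exists w l b ms, let B := block (same Ds) m w in
    [/\ [/\ w \in K, (l < M)%N & B = xorset (nseq b K ++ mask ms Ds)],
        uv.1 \in B, uv.2 \notin B & sketch p l ms B = tg uv].

Definition dec_step (m : {set U * U}) (p : nat) : {set U * U} :=
  m :|: [set uv | `[< found m p uv >]].

Definition dec_conn (L : nat) (a b : U) : bool :=
  b \in block (same Ds) (foldl dec_step set0 (iota 0 L)) a.

End Decoder.

(** * Degree sums and cuts in characteristic 2 *)

Section Char2.
Variables (U : finType) (A : zmodType).
Hypothesis addxx : forall x : A, x + x = 0.

Lemma mulrn_char2 (x : A) c : x *+ c = if odd c then x else 0.
Proof.
by elim: c => [|c IH]; rewrite ?mulr0n // mulrS IH /=; case: odd; rewrite ?addr0.
Qed.

Lemma sum_xorset (f : U -> A) (Ds : seq {set U}) :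
  \sum_(u in xorset Ds) f u = \sum_(D <- Ds) \sum_(u in D) f u.
Proof.
transitivity (\sum_u f u *+ count (fun D : {set U} => u \in D) Ds).
  rewrite [LHS]big_mkcond; apply: eq_bigr => u _.
  by rewrite inE mulrn_char2.
elim: Ds => [|D Ds IH]; first by rewrite big_nil big1.
rewrite big_cons -IH [\sum_(u in D) _]big_mkcond -big_split; apply: eq_bigr => u _ /=.
by rewrite mulrnDr; case: (u \in D).
Qed.

(** Each unordered pair occurs twice and cancels; ordering vertices by [enum_rank] pairs up the two
    occurrences. *)
Lemma sum_sym_char2 (S : {set U}) (h : U -> U -> A) :
  (forall u v, h u v = h v u) -> (forall u, h u u = 0) ->
  \sum_(u in S) \sum_(v in S) h u v = 0.
Proof.
move=> hs h0; rewrite pair_big /=.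
pose lt (uv : U * U) := (enum_rank uv.1 < enum_rank uv.2)%N.
rewrite (bigID lt) /=; set X := (X in X + _).
rewrite [X in _ + X](bigID (fun uv => uv.1 == uv.2)) /= [X in _ + (X + _)]big1; last first.
  by case=> u v /= /andP[_ /eqP->].
have sw : injective (fun uv : U * U => (uv.2, uv.1)) by case=> ? ? [? ?] /= [-> ->].
rewrite add0r [X in _ + X](reindex_inj sw) /=.
rewrite [X in _ + X](eq_big (fun uv => (uv.1 \in S) && (uv.2 \in S) && lt uv)
  (fun uv => h uv.1 uv.2)) ?addxx //.
case=> u v /=; rewrite /lt /= -leqNgt -andbA [(v \in S) && _]andbC -!andbA; do 2 congr andb.
by rewrite ltn_neqAle val_eqE (inj_eq enum_rank_inj) eq_sym andbC.
Qed.

(** The principle of linear sketches: an edge inside S is counted at both ends and cancels, so only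
    the cut remains. *)
Lemma sum_degree_cut (S : {set U}) (H : rel U) (g : U -> U -> A) :
  symmetric H -> irreflexive H -> (forall u v, g u v = g v u) ->
  \sum_(u in S) \sum_(v | H u v) g u v = \sum_(xy in edge_cut H S) g xy.1 xy.2.
Proof.
move=> Hs Hi gs; pose h u v := if H u v then g u v else 0.
have hs u v : h u v = h v u by rewrite /h Hs gs.
have h0 u : h u u = 0 by rewrite /h Hi.
transitivity (\sum_(u in S) \sum_(v | v \notin S) h u v).
  rewrite -[RHS]add0r -[X in X + _](sum_sym_char2 S hs h0) -big_split /=.
  apply: eq_bigr => u _; rewrite big_mkcond (bigID (mem S)) /=.
  by [].
rewrite pair_big /= [RHS](eq_bigl (fun xy => ((xy.1 \in S) && (xy.2 \notin S)) && H xy.1 xy.2)).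
  by rewrite [RHS]big_mkcondr.
by move=> xy; rewrite inE andbA.
Qed.

End Char2.

(** * Correctness of the sketch decoder *)

(** A false positive of the fingerprints, stated for the blocks of the ideal run and not of the
    decoder: these depend on [t] alone, so for fixed [t] this is a condition on [tg]. An empty [S]
    mistaken for an edge is included. *)
Definition bad_seed (U E : finType) (A : zmodType) (M L : nat) (base H : rel U)
    (K : {set U}) (nm : U * U -> E) (t : L.-tuple {ffun E -> 'I_(2 ^ M)})
    (w0 : {ffun E -> 'I_(2 ^ M)}) (tg : U * U -> A) : Prop :=
  exists p w l uv,
    let B := block base (foldl (ideal_step base H K nm) set0 (take p t)) w in
    let S := sampled_cut H nm (nth w0 t p) l B in
    [/\ [/\ (p < L)%N, w \in K & (l < M)%N], uv.1 \in B, uv.2 \notin B,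
        S != [set uv] & \sum_(xy in S) tg xy = tg uv].

Section Connectivity.
Variables (U E : finType) (A : zmodType) (M L : nat) (H : rel U).
Variables (par rt : U -> U) (rk : U -> nat) (nm : U * U -> E) (Fs : seq E).
Variables (ent : E -> edge_entry U A) (tg : U * U -> A).
Variables (t : L.-tuple {ffun E -> 'I_(2 ^ M)}) (w0 : {ffun E -> 'I_(2 ^ M)}).
Variable a : U.

Let K : {set U} := [set u | rt u == rt a].
Let Ds : seq {set U} := [seq eD (ent f) | f <- Fs].
Let base : rel U := same K Ds.
Let H0 : rel U := [rel u v | H u v && (nm (u, v) \notin Fs)].
Let ideal := foldl (@ideal_step U E M base H0 K nm) set0.
Let smp (p : nat) := nth w0 t p.

Definition edge_sketch (p l : nat) (u v : U) : A :=
  if (smp p (nm (u, v)) < 2 ^ l)%N then tg (u, v) else 0.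

Definition degree_sketch (p l : nat) (u : U) : A :=
  \sum_(v | H u v) edge_sketch p l u v.

Hypothesis addxx : forall x : A, x + x = 0.
Hypothesis fo : forest H par rt rk.
Hypothesis H_sym : symmetric H.
Hypothesis H_irr : irreflexive H.
Hypothesis nm_sym : forall u v, nm (u, v) = nm (v, u).
Hypothesis nm_inj : forall u v x y, nm (u, v) = nm (x, y) ->
  (x, y) = (u, v) \/ (x, y) = (v, u).
Hypothesis tg_sym : forall u v, tg (u, v) = tg (v, u).
Hypothesis Fs_uniq : uniq Fs.
Hypothesis ent_tree : forall c, par c != c -> nm (c, par c) \in Fs ->
  eD (ent (nm (c, par c))) = subtree par c.
Hypothesis ent_nontree : forall f, f \in Fs ->
  (forall c, par c != c -> nm (c, par c) != f) -> eD (ent f) = set0.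
Hypothesis ent_z : forall f p l, f \in Fs -> (p < L)%N -> (l < M)%N ->
  ez (ent f) p l = \sum_(u in eD (ent f)) degree_sketch p l u.
Hypothesis ent_ends : forall f u v, f \in Fs -> H u v -> nm (u, v) = f ->
  (eu (ent f), ev (ent f)) = (u, v) \/ (eu (ent f), ev (ent f)) = (v, u).
Hypothesis ent_y : forall f u v p l, f \in Fs -> H u v -> nm (u, v) = f ->
  (p < L)%N -> (l < M)%N -> ey (ent f) p l = edge_sketch p l u v.
Hypothesis ent_y0 : forall f p l, f \in Fs -> (p < L)%N -> (l < M)%N ->
  (forall u v, H u v -> nm (u, v) != f) -> ey (ent f) p l = 0.

Lemma ent_DP f : f \in Fs -> eD (ent f) = set0 \/
  exists c, [/\ par c != c, nm (c, par c) = f & eD (ent f) = subtree par c].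
Proof.
move=> fF; have [[c [pc ncf]]|no] := pselect (exists c, par c != c /\ nm (c, par c) = f).
  by right; exists c; split=> //; rewrite -ncf ent_tree // ncf.
by left; apply: ent_nontree => // c pc; apply/eqP => ncf; apply: no; exists c.
Qed.

(** Otherwise each of the two vertices would be the parent of the other, against the ranks. *)
Lemma tree_name_inj u v : par u != u -> par v != v ->
  nm (u, par u) = nm (v, par v) -> u = v.
Proof.
move=> pu pv /nm_inj[[-> //]|[e1 e2]].
have := par_rk fo pu; have := par_rk fo pv; rewrite e2 -e1; lia.
Qed.

(** The only tree edge leaving a subtree is the one above its top. *)
Lemma mem_eD_par u f : par u != u -> f \in Fs -> nm (u, par u) != f ->
  (u \in eD (ent f)) = (par u \in eD (ent f)).
Proof.
move=> pu fF nf; case: (ent_DP fF) => [->|[c [pc ncf ->]]]; first by rewrite !inE.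
by apply: subtree_par; apply: contraNneq nf => <-; rewrite ncf.
Qed.

Lemma base_par u : par u != u -> nm (u, par u) \notin Fs -> base u (par u).
Proof.
move=> pu nF; rewrite /base /same /= !inE (rt_par fo) eqxx /=.
apply/allP=> D /mapP[f fF ->]; apply/eqP; apply: mem_eD_par => //.
by apply: contraNneq nF => ->.
Qed.

Let base_sym : symmetric base := same_sym K Ds.
Let base_K u v : base u v -> (u \in K) = (v \in K) := @same_K _ K Ds u v.

Lemma base_trans : transitive base.
Proof.
move=> v u x /andP[/eqP uv /allP Duv] /andP[/eqP vx /allP Dvx].
apply/andP; split; first by rewrite uv vx.
by apply/allP=> D DD; rewrite (eqP (Duv D DD)) (Dvx D DD).
Qed.

Lemma H0_sym : symmetric H0.
Proof. by move=> u v; rewrite /H0 /= H_sym nm_sym. Qed.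

Lemma H0_K u v : H0 u v -> (u \in K) = (v \in K).
Proof. by case/andP=> /(edge_rt fo) uv _; rewrite !inE uv. Qed.

Lemma nm_cut (B : {set U}) : {in edge_cut H0 B &, injective nm}.
Proof.
move=> [u v] [x y]; rewrite !inE /= => /and3P[uB vB _] /and3P[xB yB _].
case/nm_inj=> [-> //|[xv _]]; by rewrite xv (negbTE vB) in xB.
Qed.

(* Of two vertices of a tree with the same signature, the one of larger rank is
   joined to its parent by a surviving edge, which preserves the signature. *)
Lemma base_conn u v : u \in K -> base u v -> connect H0 u v.
Proof.
have [k] := ubnP (rk u + rk v)%N; elim: k u v => // k IH u v ltk uK buv.
have [-> //|neuv] := eqVneq u v.
wlog le : u v ltk uK buv neuv / (rk u <= rk v)%N => [hw|].
  have [/hw-> //|/ltnW lt] := leqP (rk u) (rk v).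
  rewrite (sym_connect_sym H0_sym); apply: hw; rewrite 1?addnC 1?base_sym 1?eq_sym //.
  by rewrite -(base_K buv).
have vK : v \in K by rewrite -(base_K buv).
have pv : par v != v.
  apply: contraNneq neuv => pv; have rtv := rt_root fo pv.
  move: uK vK; rewrite !inE rtv => /eqP uK /eqP vK.
  have usub : u \in subtree par v by rewrite -rtv (subtree_rtE fo) rtv uK vK.
  by apply: contraTT le => neuv; rewrite -ltnNge; apply: subtree_rk fo _ _ usub _.
have nF : nm (v, par v) \notin Fs.
  apply/negP=> vF; have /andP[_ /allP/(_ (eD (ent (nm (v, par v)))))] := buv.
  rewrite map_f // => /(_ isT) /eqP; rewrite ent_tree // subtree_self => usub.
  by have := subtree_rk fo usub neuv; lia.
apply: (@connect_trans _ _ (par v)).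
  apply: IH => //; last exact: base_trans buv (base_par pv nF).
  by have := par_rk fo pv; lia.
rewrite (sym_connect_sym H0_sym); apply: connect1.
by rewrite /H0 /= nF andbT (par_edge fo).
Qed.

Section Block.
Variables (m : {set U * U}) (w : U).
Hypothesis sm : sound H0 K m.
Hypothesis wK : w \in K.
Let B := block base m w.

Lemma block_base u v : base u v -> (u \in B) = (v \in B).
Proof.
move=> uv; rewrite !inE; apply: (same_connect_r (connect_link_sym base_sym m)).
by apply: connect1; rewrite /link /= uv.
Qed.

Lemma B_sub_K u : u \in B -> u \in K.
Proof. exact/subsetP/(block_K base_K H0_K sm wK). Qed.

Let crossing (f : E) : bool :=
  [exists c, [&& par c != c, nm (c, par c) == f & (c \in B) != (par c \in B)]].

(** A block is a union of components of the tree without F. Walking down from the root, membership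
    in it flips exactly at the failed tree edges that cross it, and so does the parity of the
    subtrees entered. *)
Lemma block_xorset : exists b ms, B = xorset (nseq b K ++ mask ms Ds).
Proof.
(* [b] records whether the root is in the block; the mask keeps the failed tree edges with exactly
   one end in it. *)
exists (rt a \in B), (map crossing Fs).
rewrite /Ds -map_mask -filter_mask; apply/setP=> u; rewrite [RHS]inE count_cat oddD.
set cnt := fun u => count (fun D : {set U} => u \in D) [seq eD (ent f) | f <- Fs & crossing f].
have cntE v : cnt v = (\sum_(f <- Fs) (crossing f && (v \in eD (ent f))))%N.
  rewrite /cnt count_map -size_filter -filter_predI size_filter -sum1_count.
  rewrite big_mkcond; apply: eq_bigr => f _ /=.
  by rewrite andbC; case: (_ && _).
have cnt_out v : v \notin K -> cnt v = 0%N.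
  move=> vK; rewrite cntE big_seq big1 // => f fF; apply/eqP; rewrite eqb0.
  apply: contra vK => /andP[/existsP[c /and3P[pc /eqP ncf cB]]].
  rewrite -{1}ncf ent_tree ?ncf // => /(subtree_rt fo) vc.
  have cK : c \in K.
    have [/B_sub_K //|cnB] := boolP (c \in B).
    have : par c \in B by move: cB; rewrite (negbTE cnB); case: (_ \in B).
    by move/B_sub_K; rewrite !inE (rt_par fo).
  by rewrite inE vc; move: cK; rewrite inE.
have [uK|unK] := boolP (u \in K); last first.
  rewrite -/(cnt u) cnt_out //.
  have -> : count (fun D : {set U} => u \in D) (nseq (rt a \in B) K) = 0%N.
    by rewrite count_nseq (negbTE unK) mul0n.
  by apply/negP => /B_sub_K; rewrite (negbTE unK).
have -> : count (fun D : {set U} => u \in D) (nseq (rt a \in B) K) = (rt a \in B).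
  by rewrite count_nseq uK mul1n.
rewrite oddb -/(cnt u).
elim/(forest_ind fo): u uK => u pu.
  rewrite inE => /eqP ua; have -> : cnt u = 0%N.
    rewrite cntE big_seq big1 // => f fF; apply/eqP; rewrite eqb0.
    apply/negP=> /andP[/existsP[c /and3P[pc /eqP ncf cB]]].
    rewrite -{1}ncf ent_tree ?ncf // subtree_root // => /eqP uc.
    by rewrite -uc pu eqxx in pc.
  by rewrite addbF -ua (rt_root fo pu).
move=> IH uK; have puK : par u \in K by move: uK; rewrite !inE (rt_par fo).
have {IH} IH := IH puK.
(* It remains to compare u with its parent: both sides must change by the same bit. *)
suff -> : odd (cnt u) = odd (cnt (par u)) (+) ((u \in B) (+) (par u \in B)).
  by rewrite addbA -IH addbC -addbA addbb addbF.
have [uF|unF] := boolP (nm (u, par u) \in Fs); last first.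
  rewrite (block_base (base_par pu unF)) addbb addbF !cntE; congr odd.
  rewrite !big_seq; apply: eq_bigr => f fF; rewrite (mem_eD_par pu fF) //.
  by apply: contraNneq unF => ->.
have cross : crossing (nm (u, par u)) = (u \in B) (+) (par u \in B).
  rewrite -negb_eqb; apply/existsP/idP => [[c /and3P[pc /eqP ncf]]|ne].
    by rewrite (tree_name_inj pc pu ncf).
  by exists u; rewrite pu eqxx.
rewrite !cntE !(bigD1_seq _ uF Fs_uniq) /= ent_tree // subtree_self andbT cross.
have -> : (par u \in subtree par u) = false.
  by apply/negP=> /(subtree_rk fo)/(_ pu); rewrite ltnNge ltnW // (par_rk fo).
rewrite andbF add0n oddD oddb addbC; congr (odd _ (+) _).
rewrite !(big_seq_cond (fun i => i != _)); apply: eq_bigr => f /andP[fF nf].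
by rewrite (mem_eD_par pu fF) // eq_sym.
Qed.

(** The stored data determine the sampled cut of surviving edges exactly; errors can come only from
    reading a single edge off this sum. *)
Lemma sketch_block p l b ms : (p < L)%N -> (l < M)%N ->
  B = xorset (nseq b K ++ mask ms Ds) ->
  sketch [seq ent f | f <- Fs] p l ms B =
  \sum_(xy in sampled_cut H0 nm (smp p) l B) tg xy.
Proof.
move=> pL lM defB; pose g := edge_sketch p l.
have g_sym u v : g u v = g v u by rewrite /g /edge_sketch nm_sym tg_sym.
(* [K] is a full tree, so its cut is empty, and the copy of [K] in the representation of B adds
   nothing. *)
have Ksum : \sum_(u in K) degree_sketch p l u = 0.
  rewrite (sum_degree_cut addxx _ H_sym H_irr g_sym) big1 // => -[u v].
  rewrite !inE /= => /and3P[/eqP <- + /(edge_rt fo) uv].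
  by rewrite uv eqxx.
rewrite /sketch.
have -> : \sum_(e <- mask ms [seq ent f | f <- Fs]) ez e p l =
          \sum_(xy in edge_cut H B) g xy.1 xy.2.
  rewrite -(sum_degree_cut addxx _ H_sym H_irr g_sym) [in RHS]defB.
  rewrite (sum_xorset addxx) big_cat /= [X in _ = X + _]big1_seq ?add0r; last first.
    by move=> D /andP[_ /nseqP[-> _]].
  rewrite /Ds -!map_mask !big_map big_seq [RHS]big_seq.
  by apply: eq_bigr => f /mem_mask fF; exact: ent_z.
pose inF (xy : U * U) := nm xy \in Fs.
set S2 := (X in _ + X).
(* A failed edge of [H] that crosses B lies in the cut with one orientation only, whichever order
   its stored ends have; a failed edge outside [H] stores 0. *)
have -> : S2 = \sum_(xy in edge_cut H B | inF xy) g xy.1 xy.2.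
  rewrite /S2 big_map big_mkcond big_uniq //=.
  rewrite (partition_big nm (mem Fs)) /=; last by move=> xy /andP[].
  apply: eq_bigr => f fF.
  have [[[u v] [/= Huv nuv]]|no] := pselect (exists xy, H xy.1 xy.2 /\ nm xy = f); last first.
    rewrite big1 => [|xy]; last first.
      by case/andP=> /andP[]; rewrite inE => /and3P[_ _ Hxy] _ /eqP nxy; case: no; exists xy.
    rewrite ent_y0 ?if_same // => u v Huv; apply/eqP => nuv.
    by apply: no; exists (u, v).
  set x := eu (ent f); set y := ev (ent f).
  have [Hxy nxy] : H x y /\ nm (x, y) = f.
    rewrite /x /y; case: (ent_ends fF Huv nuv) => [[-> ->] //|[-> ->]].
    by rewrite H_sym nm_sym.
  rewrite (ent_y fF Hxy nxy pL lM) -/(g x y).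
  have only u' v' : H u' v' -> nm (u', v') = f -> (u', v') = (x, y) \/ (u', v') = (y, x).
    by move=> _ n'; apply: nm_inj; rewrite nxy n'.
  case: ifP => [cr|ncr]; last first.
    rewrite big1 // => -[u' v'] /andP[/andP[]]; rewrite inE /= => /and3P[uB vB H'] _ /eqP n'.
    by case: (only _ _ H' n') => -[e1 e2]; move: ncr uB vB; rewrite e1 e2; do 2 case: (_ \in B).
  have [xB|xnB] := boolP (x \in B).
    have ynB : y \notin B by move: cr; rewrite xB; case: (y \in B).
    rewrite (big_pred1 (x, y)) // => -[u' v'] /=; rewrite inE /= /inF.
    apply/idP/eqP => [/andP[/andP[/and3P[uB vB H'] _] /eqP n']|[-> ->]].
      by case: (only _ _ H' n') => // -[e1 e2]; rewrite e1 (negbTE ynB) in uB.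
    by rewrite xB ynB Hxy nxy fF eqxx.
  have yB : y \in B by move: cr; rewrite (negbTE xnB); case: (y \in B).
  rewrite (big_pred1 (y, x)) 1?g_sym // => -[u' v'] /=; rewrite inE /= /inF.
  apply/idP/eqP => [/andP[/andP[/and3P[uB vB H'] _] /eqP n']|[-> ->]].
    by case: (only _ _ H' n') => // -[e1 e2]; rewrite e1 (negbTE xnB) in uB.
  by rewrite yB xnB H_sym Hxy nm_sym nxy fF eqxx.
rewrite [X in X + _](bigID inF) /= addrAC addxx add0r.
rewrite [RHS](eq_bigl (fun xy => (xy \in edge_cut H B) && ~~ inF xy && (smp p (nm xy) < 2 ^ l)%N)).
  by rewrite [RHS]big_mkcondr; apply: eq_bigr => -[].
by move=> [u v]; rewrite !inE /= /inF -!andbA; do 3 congr andb.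
Qed.

End Block.

Lemma sound_ideal (s : seq {ffun E -> 'I_(2 ^ M)}) : sound H0 K (ideal s).
Proof.
elim/last_ind: s => [|s w IH]; first by move=> uv; rewrite inE.
rewrite /ideal foldl_rcons; apply: sound_ideal_step; [exact: base_K|exact: H0_K|exact: IH].
Qed.

(** As the sketches are exact, an edge accepted by the decoder but not isolated in the ideal run
    would be a fingerprint collision, which [bad_seed] rules out. Conversely, [block_xorset] lets
    the decoder find every isolated edge. *)
Lemma dec_ideal p : ~ bad_seed base H0 K nm t w0 tg -> (p <= L)%N ->
  foldl (dec_step M tg K [seq ent f | f <- Fs]) set0 (iota 0 p) = ideal (take p t).
Proof.
move=> nbad; elim: p => [|p IH] pL; first by rewrite take0.
rewrite -addn1 iotaD foldl_cat IH 1?ltnW //= add0n.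
have st : (p < size t)%N by rewrite size_tuple.
rewrite addn1 (take_nth w0) // /ideal foldl_rcons -/(ideal (take p t)).
have sm : sound H0 K (ideal (take p t)) by exact: sound_ideal.
 set m := ideal (take p t) in sm *.
rewrite /dec_step /ideal_step; congr (_ :|: _); apply/setP=> uv; rewrite !(inE, in_set).
have DsE : [seq eD e | e <- [seq ent f | f <- Fs]] = Ds by rewrite -map_comp.
apply/asboolP/existsP => [[w [l [b [ms []]]]]|[w /andP[wK /existsP[l /eqP sE]]]].
  rewrite DsE -/base => -[wK lM defB] uB vB skE; exists w; rewrite wK /=.
  apply/existsP; exists (Ordinal lM); apply: contra_notT nbad => ne.
  exists p, w, l, uv; split => //.
  by rewrite -(sketch_block pL lM defB).
have [b [ms defB]] := block_xorset sm wK.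
have uvB : uv \in sampled_cut H0 nm (smp p) l (block base m w) by rewrite sE inE.
move: uvB; rewrite inE => /andP[+ _]; rewrite inE => /and3P[uB vB _].
exists w, (nat_of_ord l), b, ms; rewrite DsE -/base; split=> //.
by rewrite (sketch_block pL _ defB) // /smp sE big_set1.
Qed.

Lemma dec_connE b : ~ bad_seed base H0 K nm t w0 tg -> alive base H0 K (ideal t) = set0 ->
  dec_conn M tg K [seq ent f | f <- Fs] L a b = connect H0 a b.
Proof.
move=> nbad al0; rewrite /dec_conn dec_ideal // take_oversize ?size_tuple //.
rewrite -map_comp; apply: (block_complete base_K base_conn H0_sym H0_K) => //.
  exact: sound_ideal.
by rewrite inE.
Qed.

End Connectivity.

(** * Fingerprints in a field of characteristic 2 *)

Section Seeds.
Variables (n : nat) (Fq : finFieldType).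

Definition edge_tag (x : Fq) (uv : 'I_n * 'I_n) : Fq :=
  x ^+ (uv.1 * n + uv.2)%N + x ^+ (uv.2 * n + uv.1)%N.

Lemma edge_tag_sym x u v : edge_tag x (u, v) = edge_tag x (v, u).
Proof. by rewrite /edge_tag /= addrC. Qed.

Let ptag (uv : 'I_n * 'I_n) : {poly Fq} :=
  'X^(uv.1 * n + uv.2)%N + 'X^(uv.2 * n + uv.1)%N.

Lemma pair_index_inj (u v x y : 'I_n) :
  (u * n + v == x * n + y)%N = ((u, v) == (x, y)).
Proof.
apply/eqP/eqP => [e|[-> ->] //].
have n0 : (0 < n)%N by apply: leq_ltn_trans (ltn_ord u).
have ux : u = x.
  apply: val_inj => /=; have := congr1 (fun k => (k %/ n)%N) e.
  by rewrite /= !divnMDl // !divn_small // !addn0.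
by rewrite ux; congr pair; apply: val_inj; move: e; rewrite ux => /addnI.
Qed.

Lemma pair_index_lt (u v : 'I_n) : (u * n + v < n * n)%N.
Proof. by have := ltn_ord u; have := ltn_ord v; nia. Qed.

(** The difference of the two sides is a polynomial in x of degree below n^2; the work is to see
    that it is not zero. *)
Lemma tag_collision (S : {set 'I_n * 'I_n}) (B : {set 'I_n}) (uv : 'I_n * 'I_n) :
  (forall xy, xy \in S -> (xy.1 \in B) && (xy.2 \notin B)) ->
  uv.1 \in B -> uv.2 \notin B -> S != [set uv] ->
  (#|[set x : Fq | (\sum_(xy in S) edge_tag x xy)%R == edge_tag x uv]| <= n * n)%N.
Proof.
move=> SB uB vB neS; pose P := \sum_(xy in S) ptag xy - ptag uv.
have PE x : P.[x] = \sum_(xy in S) edge_tag x xy - edge_tag x uv.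
  have tE xy : (ptag xy).[x] = edge_tag x xy by rewrite hornerD !hornerXn.
  by rewrite hornerD hornerN horner_sum tE; congr (_ - _); apply: eq_bigr => xy _.
have szt xy : (size (ptag xy) <= n * n)%N.
  rewrite (leq_trans (size_polyD _ _)) // geq_max !size_polyXn.
  by rewrite !pair_index_lt.
have szP : (size P <= n * n)%N.
  rewrite (leq_trans (size_polyD _ _)) // geq_max size_polyN szt andbT.
  by rewrite (leq_trans (size_sum _ _ _)) //; apply/bigmax_leqP => xy _.
(* All pairs are oriented out of B. The reversed monomial of a cut edge has its first index outside
   B, so it never meets the monomial of [ab]. *)
have coef (xy ab : 'I_n * 'I_n) : ab.1 \in B -> xy.2 \notin B ->
    (ptag xy)`_(ab.1 * n + ab.2) = (ab == xy)%:R.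
  case: xy ab => x y [a b] /= aB yB.
  rewrite coefD !coefXn !pair_index_inj [(a, b) == (y, x)](_ : _ = false) ?addr0 //.
  by apply: contraNF yB => /eqP[<- _].
have P0 : P != 0.
  (* A pair that tells S from the singleton of [uv] yields a coefficient 1 or -1. *)
  have [ab] : exists ab, (ab \in S) != (ab == uv).
    apply/existsP; apply: contraNT neS; rewrite negb_exists => /forallP h.
    by apply/eqP/setP=> ab; have := h ab; rewrite negbK inE => /eqP.
  move=> ne; have aB : ab.1 \in B.
    by move: ne; have [/SB/andP[] //|_] := boolP (ab \in S); have [->|] := eqVneq ab uv.
  apply/eqP => /polyP/(_ (ab.1 * n + ab.2)%N); rewrite coef0 coefB coef_sum.
  rewrite coef // (eq_bigr (fun xy => (ab == xy)%:R)); last first.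
    by move=> xy /SB/andP[_ yB]; rewrite coef.
  have -> : \sum_(xy in S) (ab == xy)%:R = (ab \in S)%:R :> Fq.
    have [abS|abS] := boolP (ab \in S).
      rewrite (bigD1 ab) //= eqxx big1 ?addr0 // => xy /andP[_ nxy].
      by rewrite eq_sym (negbTE nxy).
    rewrite big1 // => xy xyS; case: eqP => // e; by rewrite e xyS in abS.
  move: ne; case: (ab \in S); case: (ab == uv) => //= _ /eqP.
    by rewrite subr0 oner_eq0.
  by rewrite sub0r oppr_eq0 oner_eq0.
rewrite cardE; apply: leq_trans szP; apply: ltnW; apply: max_poly_roots => //.
  apply/allP=> x; rewrite mem_enum inE => /eqP e.
  by rewrite rootE PE e subrr.
exact: enum_uniq.
Qed.

(** A union bound over round, block, level and candidate edge; the last factor [n * n] bounds the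
    roots of each polynomial. With [t] fixed, the cuts do not vary with x. *)
Lemma few_bad_seeds (E : finType) (M L : nat) (base H : rel 'I_n) (K : {set 'I_n})
    (nm : 'I_n * 'I_n -> E) (t : L.-tuple {ffun E -> 'I_(2 ^ M)}) w0 :
  (#|[set x | `[< bad_seed base H K nm t w0 (edge_tag x) >]]| <= L * n * M * (n * n) * (n * n))%N.
Proof.
pose Q := ('I_L * 'I_n * 'I_M * ('I_n * 'I_n))%type.
pose B (q : Q) :=
  block base (foldl (ideal_step base H K nm) set0 (take q.1.1.1 t)) q.1.1.2.
pose S (q : Q) := sampled_cut H nm (nth w0 t q.1.1.1) q.1.2 (B q).
pose ok (q : Q) := [&& q.2.1 \in B q, q.2.2 \notin B q & S q != [set q.2]].
pose T (q : Q) := if ok q then [set x | \sum_(xy in S q) edge_tag x xy == edge_tag x q.2] else set0.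
have sub : [set x | `[< bad_seed base H K nm t w0 (edge_tag x) >]] \subset \bigcup_q T q.
  apply/subsetP=> x; rewrite inE => /asboolP[p [w [l [uv [[pL _ lM] uB vB ne eq]]]]].
  apply/bigcupP; exists (Ordinal pL, w, Ordinal lM, uv) => //.
  by rewrite /T /ok uB vB ne inE eq.
apply: leq_trans (subset_leq_card sub) _.
apply: (@leq_trans (\sum_q #|T q|)).
  elim/big_ind2: _ => [|X a Y b le1 le2|//]; first by rewrite cards0.
  by apply: leq_trans (leq_add le1 le2); rewrite -cardsUI leq_addr.
apply: (@leq_trans (\sum_(q : Q) n * n)%N).
  apply: leq_sum => q _; rewrite /T; case: ifP => [/and3P[uB vB ne]|_]; last by rewrite cards0.
  apply: tag_collision uB vB ne => xy; rewrite inE => /andP[+ _].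
  by rewrite inE => /and3P[-> -> _].
by rewrite sum_nat_const !card_prod !card_ord.
Qed.

End Seeds.

(** The exponent is [m.+1], hence positive for every [m]. *)
Definition GF (m : nat) : finFieldType := s2val (@pPrimePowerField 2 m.+1 isT isT).

Lemma card_GF m : #|GF m| = (2 ^ m.+1)%N.
Proof. exact: (s2valP' (@pPrimePowerField 2 m.+1 isT isT)). Qed.

Lemma GF_addxx m (x : GF m) : x + x = 0.
Proof. exact: addrr_pchar2 (s2valP (@pPrimePowerField 2 m.+1 isT isT)) x. Qed.

(** * Walks and sparse covers *)

Section Walks.
Variables (R : realType) (V : finType) (G : wgraph R V).
Hypothesis weight_ge1 : forall e, e \in edges G -> 1 <= weight G e.

Definition on_edges (e : rel V) : Prop := forall u v, e u v -> [set u; v] \in edges G.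

Definition near (e : rel V) (r : R) (u v : V) : Prop :=
  exists p, [/\ path e u p, last u p = v & walk_weight G u p <= r].

Lemma walk_weight_cat u p q :
  walk_weight G u (p ++ q) = walk_weight G u p + walk_weight G (last u p) q.
Proof. by elim: p u => [|x p IH] u /=; rewrite ?add0r // IH addrA. Qed.

Lemma walk_weight_size e u p : on_edges e -> path e u p ->
  (size p)%:R <= walk_weight G u p.
Proof.
move=> eG; elim: p u => [|x p IH] u //= /andP[/eG/weight_ge1 ux /IH le].
by rewrite -natr1 addrC lerD.
Qed.

Lemma walk_weight_ge0 e u p : on_edges e -> path e u p -> 0 <= walk_weight G u p.
Proof. by move=> eG /(walk_weight_size eG); apply: le_trans. Qed.

Lemma near0 e u : near e 0 u u.
Proof. by exists [::]. Qed.

Lemma near_le e r r' u v : r <= r' -> near e r u v -> near e r' u v.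
Proof. by move=> le [p [pp lp wp]]; exists p; split=> //; apply: le_trans wp le. Qed.

Lemma near_trans e r r' u v x : near e r u v -> near e r' v x -> near e (r + r') u x.
Proof.
move=> [p [pp lp wp]] [q [pq lq wq]]; exists (p ++ q).
by rewrite cat_path last_cat walk_weight_cat lp pp pq; split=> //; exact: lerD.
Qed.

Lemma near1 (e : rel V) r u v : e u v -> weight G [set u; v] <= r -> near e r u v.
Proof. by move=> uv w; exists [:: v]; rewrite /= uv addr0. Qed.

Lemma near_sym e r u v : symmetric e -> near e r u v -> near e r v u.
Proof.
move=> es [p [pp <- wp]]; apply: near_le wp _.
elim: p u pp => [|x p IH] u /=; first by move=> _; exact: near0.
case/andP=> ux /IH np; rewrite addrC; apply: near_trans np _.
by apply: near1; rewrite 1?es // setUC.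
Qed.

Lemma near_sub e e' r u v : subrel e e' -> near e r u v -> near e' r u v.
Proof. by move=> s [p [pp lp wp]]; exists p; split=> //; exact: sub_path s _ _ pp. Qed.

Lemma walk_near e u p x : on_edges e -> path e u p -> x \in u :: p ->
  near e (walk_weight G u p) u x.
Proof.
move=> eG pp; rewrite inE => /orP[/eqP->|].
  by apply: near_le (near0 e u); exact: walk_weight_ge0 eG pp.
move=> xp; case/splitPr: xp pp => p1 p2; rewrite -cat_rcons cat_path walk_weight_cat last_rcons => /andP[pp1 pp2].
exists (rcons p1 x); rewrite last_rcons; split=> //.
by rewrite lerDl; exact: walk_weight_ge0 eG pp2.
Qed.

Lemma walk_edge_le e u p q x y r : on_edges e -> path e u (p ++ y :: q) ->
  last u p = x -> walk_weight G u (p ++ y :: q) <= r -> weight G [set x; y] <= r.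
Proof.
move=> eG; rewrite cat_path walk_weight_cat /= => /and3P[pp xy pq] <-.
by apply: le_trans; rewrite addrCA lerDl addr_ge0 ?(walk_weight_ge0 eG pp) ?(walk_weight_ge0 eG pq).
Qed.

(* As edge weights are at least 1, only finitely many walks compete. *)
Lemma min_walk e u v : on_edges e -> connect e u v ->
  exists p, [/\ path e u p, last u p = v &
    forall q, path e u q -> last u q = v -> walk_weight G u p <= walk_weight G u q].
Proof.
move=> eG /connectP[p0 pp0 v0].
pose N := Num.bound (walk_weight G u p0).
have szN q : path e u q -> walk_weight G u q <= walk_weight G u p0 -> (size q <= N)%N.
  move=> pq le; rewrite ltnW // -(ltr_nat R) (le_lt_trans (walk_weight_size eG pq)) //.
  by rewrite (le_lt_trans le) // archi_boundP // (walk_weight_ge0 eG pp0).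
pose b0 : N.-bseq V := Bseq (szN _ pp0 (lexx _)).
pose P (b : N.-bseq V) := path e u b && (last u b == v).
have Pb0 : P b0 by rewrite /P pp0 v0 eqxx.
pose b := [arg min_(b < b0 | P b) walk_weight G u b]%O.
have [/andP[pb /eqP lb] bmin] : P b /\ forall c, P c -> walk_weight G u b <= walk_weight G u c.
  by rewrite /b; case: arg_minP => // i Pi imin; split.
exists b; split=> // q pq lq.
have [le|/ltW ge] := leP (walk_weight G u q) (walk_weight G u p0); last first.
  exact: le_trans (bmin _ Pb0) ge.
by apply: (bmin (Bseq (szN _ pq le))); rewrite /P pq lq eqxx.
Qed.

End Walks.

(** * Sparse covers by region growing *)

Lemma bernoulli_real (R : realFieldType) (y : R) (k : nat) : -1 <= y ->
  1 + k%:R * y <= (1 + y) ^+ k.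
Proof.
move=> y1; elim: k => [|k IH]; first by rewrite mul0r addr0 expr0.
have y0 : 0 <= 1 + y by lra.
rewrite exprS; apply: le_trans (ler_wpM2l y0 IH).
have k0 : 0 <= k%:R * y ^+ 2 :> R by rewrite mulr_ge0 // sqr_ge0.
by rewrite -natr1 expr2 in k0 *; nra.
Qed.

Section Cover.
Variables (R : realType) (V : finType) (I : rel V) (k : nat).
Hypothesis I_refl : reflexive I.
Hypothesis I_sym : symmetric I.
Hypothesis k_gt0 : (0 < k)%N.

(* The clusters {u in A | ctr u = r} are pairwise non-adjacent, and each is
   reached from its centre r in fewer than k hops inside the cluster. *)
Record clustering (A : {set V}) (ctr : V -> V) (h : V -> nat) : Prop := Clustering {
  ctr_adj : forall u w, u \in A -> w \in A -> I u w -> ctr u = ctr w;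
  ctr_in : forall u, u \in A -> ctr u \in A;
  ctr_idem : forall u, u \in A -> ctr (ctr u) = ctr u;
  hop_lt : forall u, u \in A -> (h u < k)%N;
  hop_step : forall u, u \in A -> u = ctr u \/
    exists w, [/\ w \in A, ctr w = ctr u, I w u & (h w < h u)%N]
}.

(** If all of the first k steps grew by more than tau, the last layer would exceed tau^k, hence
    |U|. *)
Lemma ball_growth (U : {set V}) (v : V) (tau : R) (N : nat -> {set V}) :
  0 <= tau -> N 0 = [set v] -> (forall j, N j \subset U) -> #|U|%:R <= tau ^+ k ->
  exists2 j, (j < k)%N & #|N j.+1|%:R <= tau * #|N j|%:R.
Proof.
move=> tau0 N0 NU Uk; apply: contrapT => no.
have gr j : (j <= k)%N -> tau ^+ j <= #|N j|%:R.
  elim: j => [|j IH] jk; first by rewrite N0 cards1 expr0.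
  have [le|/ltW] := leP #|N j.+1|%:R (tau * #|N j|%:R); first by case: no; exists j.
  by apply: le_trans; rewrite exprS ler_wpM2l // IH // ltnW.
apply: no; exists k.-1; first by rewrite prednK.
rewrite prednK //; apply: le_trans (_ : #|U|%:R <= _); first by rewrite ler_nat subset_leq_card.
apply: le_trans Uk _; rewrite -[k in tau ^+ k](prednK k_gt0) exprS ler_wpM2l // gr //.
exact: leq_pred.
Qed.

(* Region growing: a ball is output as soon as its next neighbourhood is at most
   tau times larger, and that neighbourhood is discarded. *)
Lemma one_phase (tau : R) (U : {set V}) : 0 <= tau -> #|U|%:R <= tau ^+ k ->
  exists A ctr h, [/\ clustering A ctr h, A \subset U & #|U|%:R <= tau * #|A|%:R].
Proof.
move=> tau0; have [m] := ubnP #|U|; elim: m U => // m IH U ltU Uk.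
have [->|[v vU]] := set_0Vmem U.
  exists set0, id, (fun=> 0%N); rewrite cards0 mulr0 sub0set; split=> //.
  by split=> u; rewrite inE.
pose N := fix N j := if j is j'.+1 then [set u in U | [exists w in N j', I w u]] else [set v].
have NU j : N j \subset U.
  by case: j => [|j] /=; [rewrite sub1set|apply/subsetP=> u; rewrite inE => /andP[]].
have NS j : N j \subset N j.+1.
  apply/subsetP=> u uN; rewrite inE (subsetP (NU j)) //=.
  by apply/existsP; exists u; rewrite uN I_refl.
have NM i j : (i <= j)%N -> N i \subset N j.
  by elim: j => [|j IHj]; rewrite leq_eqVlt => /orP[/eqP-> //|] // /IHj /subset_trans; apply.
have [j jk grow] := ball_growth tau0 (erefl : N 0%N = [set v]) NU Uk.
pose U' := U :\: N j.+1.
have vN i : v \in N i by apply: (subsetP (NM 0%N i _)); rewrite // inE.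
have ltU' : (#|U'| < m)%N.
  rewrite -ltnS; apply: leq_trans ltU; rewrite ltnS; apply: proper_card; apply/properP.
  by split; [exact: subsetDl|exists v => //; rewrite inE vN].
have U'k : #|U'|%:R <= tau ^+ k.
  by apply: le_trans Uk; rewrite ler_nat subset_leq_card // subsetDl.
have [A' [ctr' [h' [cl' A'U le']]]] := IH U' ltU' U'k.
pose h0 u := find (fun i => u \in N i) (iota 0 k).
have h0P u : u \in N j -> [/\ (h0 u <= j)%N, u \in N (h0 u) & forall i, (i < h0 u)%N -> u \notin N i].
  move=> uN; have hs : has (fun i => u \in N i) (iota 0 k).
    by apply/hasP; exists j => //; rewrite mem_iota.
  have hk : (h0 u < k)%N by move: hs; rewrite has_find size_iota.
  have bf i : (i < h0 u)%N -> u \notin N i.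
    move=> ih; have := before_find 0%N ih.
    by rewrite nth_iota ?add0n ?(ltn_trans ih) // => ->.
  split=> //; first by rewrite leqNgt; apply: contraL uN; exact: bf.
  by have := nth_find 0%N hs; rewrite nth_iota.
have disj u : u \in A' -> u \notin N j.+1 by move/(subsetP A'U); rewrite inE => /andP[].
have disj0 u : u \in A' -> u \notin N j.
  by move/disj; apply: contra; exact/subsetP.
pose ctr u := if u \in N j then v else ctr' u.
pose h u := if u \in N j then h0 u else h' u.
exists (N j :|: A'), ctr, h; split.
- split=> [u w|u|u|u|u].
  (* A remaining vertex adjacent to the ball would lie in the discarded neighbourhood. *)
  + have out x y : x \in N j -> y \in A' -> I x y = false.
      move=> xN yA; apply: contraNF (disj y yA) => xy; rewrite inE.
      have /(subsetP A'U) := yA; rewrite inE => /andP[_ ->] /=.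
      by apply/existsP; exists x; rewrite xN.
    rewrite !inE /ctr => /orP[uN|uA] /orP[wN|wA]; rewrite ?uN ?wN //.
    * by rewrite out.
    * by rewrite I_sym out.
    * by rewrite (negbTE (disj0 _ uA)) (negbTE (disj0 _ wA)); apply: (ctr_adj cl' uA wA).
  + rewrite !inE /ctr => /orP[->|uA]; first by rewrite vN.
    by rewrite (negbTE (disj0 _ uA)) (ctr_in cl') ?orbT.
  + rewrite !inE /ctr => /orP[->|uA]; first by rewrite vN.
    rewrite (negbTE (disj0 _ uA)) (negbTE (disj0 _ (ctr_in cl' uA))).
    exact: ctr_idem cl' _ uA.
  + rewrite !inE /h => /orP[uN|uA]; last by rewrite (negbTE (disj0 _ uA)) (hop_lt cl').
    by rewrite uN; have [le _ _] := h0P _ uN; exact: leq_ltn_trans le jk.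
  + rewrite !inE /ctr /h => /orP[uN|uA].
      rewrite uN; have [le uh bf] := h0P _ uN; case hu: (h0 u) => [|i].
        by left; move: uh; rewrite hu /= => /set1P.
      right; move: uh; rewrite hu /= inE => /andP[_ /existsP[w /andP[wN Iwu]]].
      have wNj : w \in N j by apply: subsetP wN; apply: NM; rewrite hu in le; exact: ltnW.
      exists w; rewrite inE wNj; split=> //.
      have [_ _ bw] := h0P _ wNj; rewrite ltnS leqNgt; apply: contraL wN; exact: bw.
    rewrite (negbTE (disj0 _ uA)); have [e|[w [wA cw Iwu hw]]] := hop_step cl' uA; first by left.
    by right; exists w; rewrite inE wA orbT (negbTE (disj0 _ wA)).
- rewrite subUset NU; apply: subset_trans A'U (subsetDl _ _).
- have -> : #|U| = (#|N j.+1| + #|U'|)%N by rewrite -(cardsID (N j.+1) U) (setIidPr (NU _)).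
  have -> : #|N j :|: A'| = (#|N j| + #|A'|)%N.
    rewrite cardsU [_ :&: _](_ : _ = set0) ?cards0 ?subn0 //.
    apply/setP=> u; rewrite !inE; apply/negP => /andP[uN /disj0]; by rewrite uN.
  by rewrite !natrD mulrDr lerD.
Qed.

Definition kroot (m : nat) : R := m%:R `^ (k%:R^-1).

Lemma kroot_ge0 m : 0 <= kroot m. Proof. exact: powR_ge0. Qed.

Lemma kroot_exp m : kroot m ^+ k = m%:R.
Proof.
rewrite -powR_mulrn ?kroot_ge0 // /kroot -powRrM mulVf ?powRr1 //.
by rewrite pnatr_eq0 -lt0n.
Qed.

Lemma kroot_le m (y : R) : 0 <= y -> m%:R <= y ^+ k -> kroot m <= y.
Proof.
move=> y0 le; rewrite leNgt; apply/negP => lt.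
by move: le; rewrite -kroot_exp ler_pXn2r ?nnegrE ?kroot_ge0 // leNgt lt.
Qed.

Lemma kroot_ge1 m : (0 < m)%N -> 1 <= kroot m.
Proof.
move=> m0; rewrite leNgt; apply/negP => lt1.
have : kroot m ^+ k < 1 by rewrite exprn_ilt1 ?kroot_ge0 // -lt0n.
by rewrite kroot_exp ltNge ler1n m0.
Qed.

(** The potential k |U|^(1/k) drops by at least 1 per phase: with tau = x = |U|^(1/k), a phase
    covers at least |U|/x vertices. *)
Lemma cover_phases (U : {set V}) :
  exists P (A : nat -> {set V}) (ctr : nat -> V -> V) (h : nat -> V -> nat),
    [/\ forall p, (p < P)%N -> clustering (A p) (ctr p) (h p),
        forall v, v \in U -> exists2 p, (p < P)%N & v \in A p,
        P%:R <= k%:R * kroot #|U| & (P <= #|U|)%N].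
Proof.
have [m] := ubnP #|U|; elim: m U => // m IH U ltU.
have [->|U0] := eqVneq U set0.
  exists 0%N, (fun=> set0), (fun=> id), (fun=> fun=> 0%N); split=> //.
    by move=> v; rewrite inE.
  by rewrite mulr_ge0 // kroot_ge0.
have cU : (0 < #|U|)%N by rewrite card_gt0.
set x := kroot #|U|; have x1 : 1 <= x by exact: kroot_ge1.
have x0 : 0 < x by lra.
have [A0 [c0 [h0 [cl AU le]]]] : exists A ctr h,
    [/\ clustering A ctr h, A \subset U & #|U|%:R <= x * #|A|%:R].
  by apply: one_phase; [exact: ltW|rewrite /x kroot_exp].
have cA : (0 < #|A0|)%N.
  rewrite lt0n; apply/eqP => A00; move: le; rewrite A00 mulr0 leNgt.
  by rewrite ltr0n cU.
have cD : (#|U :\: A0| + #|A0| = #|U|)%N by rewrite addnC -(cardsID A0 U) (setIidPr AU).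
have ltD : (#|U :\: A0| < m)%N by lia.
have [P [A [ctr [h [clP cov Pk PU]]]]] := IH _ ltD.
exists P.+1, (fun p => if p is p'.+1 then A p' else A0),
  (fun p => if p is p'.+1 then ctr p' else c0), (fun p => if p is p'.+1 then h p' else h0).
split; last 2 first.
- have k1 : 1 <= k%:R :> R by rewrite ler1n.
  have k0 : 0 < k%:R :> R by lra.
  rewrite -natr1; suff le2 : kroot #|U :\: A0| <= x - k%:R^-1.
    apply: le_trans (lerD Pk (lexx 1)) _; apply: le_trans (lerD (ler_wpM2l (ltW k0) le2) (lexx 1)) _.
    by rewrite mulrBr divff ?gt_eqF // subrK.
  have ki1 : k%:R^-1 <= 1 :> R by rewrite invf_le1.
  apply: kroot_le; first by lra.
  have -> : x - k%:R^-1 = x * (1 - (k%:R * x)^-1).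
    by field; rewrite !gt_eqF.
  (* Bernoulli gives (x - 1/k)^k >= x^k - x^k/x = |U| - |U|/x, which is at least the number of
     uncovered vertices. *)
  rewrite exprMn; have := @bernoulli_real R (- (k%:R * x)^-1) k.
  have kx : 1 <= k%:R * x by nra.
  have kxi : (k%:R * x)^-1 <= 1 by rewrite invf_le1 //; lra.
  move=> /(_ _)/wrap[]; first by lra.
  rewrite mulrN invfM mulrA divff ?gt_eqF // mul1r => bern.
  have xk0 : 0 <= x ^+ k by rewrite exprn_ge0 // ltW.
  apply: le_trans (ler_wpM2l xk0 bern).
  have -> : #|U :\: A0|%:R = #|U|%:R - #|A0|%:R :> R by rewrite -cD natrD addrK.
  rewrite kroot_exp mulrBr mulr1 lerD2l lerN2.
  by rewrite ler_pdivrMr // mulrC.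
- lia.
- by case=> [|p] //= /clP.
- move=> v vU; have [vA|vA] := boolP (v \in A0); first by exists 0%N.
  have [|p pP vp] := cov v; first by rewrite inE vA.
  by exists p.+1.
Qed.

End Cover.

(** * Cluster graphs and detours *)

Section Instance.
Variables (R : realType) (V : finType) (G : wgraph R V).
Hypothesis weight_ge1 : forall e, e \in edges G -> 1 <= weight G e.

Lemma adj_on_edges F : on_edges G (adj_minus G F).
Proof. by move=> u v; rewrite /adj_minus /= inE => /andP[]. Qed.

Lemma adj_sym F : symmetric (adj_minus G F).
Proof. by move=> u v; rewrite /adj_minus /= setUC. Qed.

Record cluster_graph (r D : R) (H : rel V) (par rt : V -> V) (rk : V -> nat)
    (dp : V -> R) : Prop := ClusterGraph {
  cg_sym : symmetric H;
  cg_edge : forall u v, H u v -> [set u; v] \in edges G;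
  cg_light : forall u v, H u v -> weight G [set u; v] <= r;
  cg_forest : forest H par rt rk;
  cg_depth_ge0 : forall v, 0 <= dp v;
  cg_depth : forall v, dp v <= D;
  cg_depth_par : forall v, par v != v -> dp (par v) + weight G [set v; par v] <= dp v
}.

Lemma edge_irr (H : rel V) : (forall u v, H u v -> [set u; v] \in edges G) -> irreflexive H.
Proof.
move=> HG u; apply/negP => /HG /edges_card2.
by rewrite setUid cards1.
Qed.

Section Phase.
Variables (rho : R) (k : nat).
Hypothesis rho_ge0 : 0 <= rho.

Let adj := adj_minus G set0.
Definition in_ball : rel V := [rel u v | `[< near G adj rho u v >]].
(** Balls are clustered rather than vertices: clusters non-adjacent in this intersection graph have
    disjoint unions of balls, and each ball stays whole. *)
Definition balls_meet : rel V := [rel u w | [exists z, in_ball u z && in_ball w z]].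

Lemma in_ball_refl u : in_ball u u.
Proof. by apply/asboolP; apply: near_le rho_ge0 (near0 _ _ _). Qed.

Lemma balls_meet_refl : reflexive balls_meet.
Proof. by move=> u; apply/existsP; exists u; rewrite in_ball_refl. Qed.

Lemma balls_meet_sym : symmetric balls_meet.
Proof. by move=> u w; apply: eq_existsb => z; rewrite andbC. Qed.

Variables (A : {set V}) (ctr : V -> V) (h : V -> nat).
Hypothesis cl : clustering balls_meet k A ctr h.

(** The cluster of y, named by its centre; by [cid_eq] the ball picked does not matter. [None] marks
    the vertices that the phase leaves uncovered. *)
Let cid (y : V) : option V := omap ctr [pick u in A | in_ball u y].
Let H : rel V := [rel u v | [&& [set u; v] \in edges G, cid u == cid v, cid u != None &
  weight G [set u; v] <= rho]].
Let rt (v : V) : V := odflt v (cid v).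
Let D : R := (2 * k%:R - 1) * rho.

Lemma cid_eq u y : u \in A -> in_ball u y -> cid y = Some (ctr u).
Proof.
move=> uA uy; rewrite /cid; case: pickP => [w /andP[wA wy]|/(_ u)]; last by rewrite uA uy.
by rewrite /= (ctr_adj cl wA uA) //; apply/existsP; exists y; rewrite wy.
Qed.

Lemma H_sym : symmetric H.
Proof.
move=> u v; rewrite /H /= setUC [cid u == _]eq_sym; congr andb.
by case: eqP => [->|].
Qed.

Lemma H_on_edges : on_edges G H.
Proof. by move=> u v /and4P[]. Qed.

Lemma ball_path F u s p : u \in A -> in_ball u s ->
  path (adj_minus G F) s p -> (forall x, x \in s :: p -> in_ball u x) ->
  (forall q1 x q2, p = q1 ++ x :: q2 -> weight G [set last s q1; x] <= rho) ->
  path [rel u v | H u v && ([set u; v] \notin F)] s p.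
Proof.
move=> uA; elim: p s => //= x p IH s us /andP[sx pp] ball light.
have ux : in_ball u x by apply: ball; rewrite !inE eqxx orbT.
move: sx; rewrite /adj_minus /= inE => /andP[sF sE].
have Hsx : H s x by rewrite /H /= sE (cid_eq uA us) (cid_eq uA ux) eqxx (light [::] x p).
rewrite Hsx sF /=.
apply: IH => // [y yp|q1 y q2 pE]; first by apply: ball; rewrite inE yp orbT.
by have := light (x :: q1) y q2; rewrite /= pE; apply.
Qed.

Lemma ball_near u y : u \in A -> in_ball u y -> near G H rho u y.
Proof.
move=> uA /asboolP[p [pp lp wp]]; exists p; split=> //.
have aE := @adj_on_edges set0.
apply: sub_path (ball_path uA (in_ball_refl u) pp _ _); first by move=> x z /andP[].
  move=> x xp; apply/asboolP; apply: near_le wp _; exact: walk_near aE pp xp.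
move=> q1 x q2 pE; rewrite pE in pp wp.
exact: (walk_edge_le weight_ge1 aE pp (erefl _) wp).
Qed.

Lemma centre_near u : u \in A -> near G H ((h u)%:R * (2 * rho)) u (ctr u).
Proof.
have [m] := ubnP (h u); elim: m u => // m IH u ltm uA.
have [e|[w [wA cw /existsP[z /andP[wz uz]] hw]]] := hop_step cl uA.
  by rewrite -e; apply: near_le (near0 _ _ _); rewrite !mulr_ge0.
have nw : near G H ((h w)%:R * (2 * rho)) w (ctr w) by apply: IH => //; lia.
rewrite -cw; apply: near_le (near_trans (near_trans (ball_near uA uz)
  (near_sym H_sym (ball_near wA wz))) nw).
have : (h w)%:R + 1 <= (h u)%:R :> R by rewrite natr1 ler_nat.
move=> le; rewrite (_ : _ + _ = ((h w)%:R + 1) * (2 * rho)); last by ring.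
by rewrite ler_wpM2r // mulr_ge0.
Qed.

Hypothesis k_gt0 : (0 < k)%N.

Lemma D_ge0 : 0 <= D.
Proof.
rewrite /D mulr_ge0 // subr_ge0; have : 1 <= k%:R :> R by rewrite ler1n.
lra.
Qed.

(** One radius leads from v to the centre of a ball containing it; then at most k-1 hops between
    meeting balls cost two radii each. *)
Lemma rt_near v : near G H D v (rt v).
Proof.
rewrite /rt /cid; case: pickP => [u /andP[uA uv]|_] /=; last first.
  exact: near_le D_ge0 (near0 _ _ _).
apply: near_le (near_trans (near_sym H_sym (ball_near uA uv)) (centre_near uA)).
have : (h u)%:R + 1 <= k%:R :> R by rewrite natr1 ler_nat (hop_lt cl).
move=> le; rewrite /D [X in X <= _](_ : _ = (2 * ((h u)%:R + 1) - 1) * rho); last by ring.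
by rewrite ler_wpM2r // lerB // ler_pM2l.
Qed.

Lemma H_cid u v : H u v -> cid u = cid v.
Proof. by case/and4P=> _ /eqP. Qed.

Lemma H_rt u v : H u v -> rt u = rt v.
Proof.
move=> uv; rewrite /rt -(H_cid uv).
by have /and4P[_ _ + _] := uv; case: (cid u).
Qed.

(** The parent of v is the second vertex of a lightest walk to the centre. As weights are at least
    1, the depth strictly decreases towards the parent. *)
Lemma phase_graph : exists H' par rt rk dp, cluster_graph rho D H' par rt rk dp /\
  forall s, s \in A -> forall F t, near G (adj_minus G F) rho s t ->
    connect [rel u v | H' u v && ([set u; v] \notin F)] s t.
Proof.
have exw v : exists p, [/\ path H v p, last v p = rt v &
    forall q, path H v q -> last v q = rt v -> walk_weight G v p <= walk_weight G v q].
  apply: (min_walk weight_ge1 H_on_edges).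
  by have [p [pp lp _]] := rt_near v; apply/connectP; exists p.
have [w wP] := choice exw.
pose dp v := walk_weight G v (w v); pose par v := head v (w v).
have irr : irreflexive H by apply: edge_irr; exact: H_on_edges.
have parP v : par v != v -> H v (par v) /\ dp (par v) + weight G [set v; par v] <= dp v.
  have [pp lp _] := wP v; rewrite /par /dp.
  case: (w v) pp lp => [|x p] /=; first by rewrite eqxx.
  case/andP=> vx px lp _; split=> //; rewrite addrC lerD2l.
  have [_ _ mn] := wP x; apply: mn => //; by rewrite lp (H_rt vx).
have dp_lt v : par v != v -> dp (par v) < dp v.
  case/parP=> Hv; have := weight_ge1 (H_on_edges Hv); lra.
(* Counting the vertices of smaller depth turns the real depth into a natural rank. *)
exists H, par, rt, (fun v => #|[set u | dp u < dp v]|), dp; split; first split.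
- exact: H_sym.
- exact: H_on_edges.
- by move=> u v /and4P[].
- split=> [u pu|u /parP[] //|u|u|u v /H_rt //].
  + apply: proper_card; apply/properP; split.
      by apply/subsetP=> x; rewrite !inE => /lt_trans; apply; exact: dp_lt.
    by exists (par u); rewrite !inE ?ltxx // dp_lt.
  + by have [->|/parP[/H_rt -> _]] := eqVneq (par u) u.
  + have [pp lp _] := wP u; rewrite /par; case: (w u) pp lp => [//|x p] /=.
    by case/andP=> ux _ _ xu; rewrite xu irr in ux.
- by move=> v; have [pp _ _] := wP v; exact: walk_weight_ge0 H_on_edges pp.
- move=> v; have [p [pp lp wp]] := rt_near v; have [_ _ mn] := wP v.
  exact: le_trans (mn p pp lp) wp.
- by move=> v /parP[].
(* A walk of weight at most rho avoiding F lies in the fault-free ball of s, hence in one cluster,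
   and each of its edges is light. *)
move=> s sA F t [p [pp lp wp]]; apply/connectP; exists p => //.
have aE := @adj_on_edges F.
have sub0 : subrel (adj_minus G F) adj.
  by move=> x y; rewrite /adj /adj_minus /= !inE => /andP[].
apply: (ball_path sA (in_ball_refl s) pp) => [x xp|q1 x q2 pE].
  apply/asboolP; apply: near_sub sub0 _; apply: near_le wp _; exact: walk_near aE pp xp.
rewrite pE in pp wp.
exact: (walk_edge_le weight_ge1 aE pp (erefl _) wp).
Qed.

End Phase.

(** * Detours around failed tree edges *)

Section Detour.
Variables (r D : R) (H : rel V) (par rt : V -> V) (rk : V -> nat) (dp : V -> R).
Hypothesis cg : cluster_graph r D H par rt rk dp.
Variable F : {set {set V}}.
Hypotheses (r_ge0 : 0 <= r) (depth_ge0 : 0 <= D).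

Let H0 : rel V := [rel u v | H u v && ([set u; v] \notin F)].
Let fo := cg_forest cg.

Lemma H0_adj : subrel H0 (adj_minus G F).
Proof. by move=> u v /andP[/(cg_edge cg) uv uF]; rewrite /adj_minus /= inE uF. Qed.

(** Climb until the root or a failed tree edge stops the walk; each step lowers the depth by at
    least the weight of its edge. *)
Lemma top_exists v : exists x, [/\ rt x = rt v,
  x = rt v \/ (par x != x) && ([set x; par x] \in F) &
  near G (adj_minus G F) (dp v) v x].
Proof.
elim/(forest_ind fo): v => v pv.
  exists v; rewrite (rt_root fo pv); split=> //; first by left.
  exact: near_le (cg_depth_ge0 cg v) (near0 _ _ _).
move=> [x [rx tx nx]]; have [vF|vF] := boolP ([set v; par v] \in F).
  exists v; split=> //; first by right; rewrite pv.
  exact: near_le (cg_depth_ge0 cg v) (near0 _ _ _).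
exists x; rewrite -(rt_par fo v); split=> //.
apply: near_le (cg_depth_par cg pv) _; rewrite addrC; apply: near_trans nx.
by apply: near1 => //; apply: H0_adj; rewrite /H0 /= (par_edge fo).
Qed.

(* A component of the forest minus F is named by its top; inside one cluster there
   are at most |F| + 1 tops, so a shortest sequence of components has at most |F|
   crossing edges. *)
Lemma detour s t : connect H0 s t ->
  near G (adj_minus G F) ((2 * D + r) * (#|F|%:R + 1)) s t.
Proof.
have [top topP] := choice top_exists.
pose Q : rel V := [rel x y | [exists u, exists v, [&& H0 u v, top u == x & top v == y]]].
have QN x y : Q x y -> near G (adj_minus G F) (2 * D + r) x y.
  case/existsP=> u /existsP[v /and3P[uv /eqP <- /eqP <-]].
  have [_ _ nu] := topP u; have [_ _ nv] := topP v.
  have nuv : near G (adj_minus G F) r u v.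
    by apply: near1; [exact: H0_adj|apply: (cg_light cg); case/andP: uv].
  apply: near_le (near_trans (near_trans (near_sym (adj_sym F) nu) nuv) nv).
  by have := cg_depth cg u; have := cg_depth cg v; lra.
have Qrt x y : Q x y -> rt x = rt y.
  case/existsP=> u /existsP[v /and3P[/andP[uv _] /eqP <- /eqP <-]].
  by have [-> _ _] := topP u; have [-> _ _] := topP v; exact: edge_rt fo _ _ uv.
pose TS := rt s |: [set x | (par x != x) && ([set x; par x] \in F)].
have cTS : (#|TS| <= #|F|.+1)%N.
  apply: leq_trans (leq_card_setU _ _) _; rewrite cards1 add1n ltnS.
  have inj : {in [set x | (par x != x) && ([set x; par x] \in F)] &,
      injective (fun x => [set x; par x])}.
    move=> x y; rewrite !inE => /andP[px _] /andP[py _] e.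
    have : x \in [set y; par y] by rewrite -e !inE eqxx.
    have : y \in [set x; par x] by rewrite e !inE eqxx.
    rewrite !inE => /orP[/eqP-> //|/eqP yx] /orP[/eqP-> //|/eqP xy].
    have := par_rk fo px; have := par_rk fo py; rewrite -xy -yx; lia.
  rewrite -(card_in_imset inj); apply: subset_leq_card; apply/subsetP=> f.
  by case/imsetP=> x; rewrite inE => /andP[_ xF] ->.
have topTS v : rt v = rt s -> top v \in TS.
  move=> vs; have [_ + _] := topP v; rewrite !inE vs.
  by case=> [->|->]; rewrite ?eqxx ?orbT.
move=> /connectP[p pp ->].
have : connect Q (top s) (top (last s p)) /\ rt (last s p) = rt s.
  elim/last_ind: p pp => [_|p x IH]; first by split.
  rewrite rcons_path last_rcons => /andP[/IH[c e] px]; split.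
    apply: connect_trans c (connect1 _); apply/existsP; exists (last s p).
    by apply/existsP; exists x; rewrite px !eqxx.
  by rewrite -e; have /andP[/(edge_rt fo) -> _] := px.
move: {p pp}(last s p) => t' [/connectP[q0 pq0]].
case/shortenP: pq0 => q pq uq _ {q0} lq rt'.
have qTS : {subset top s :: q <= TS}.
  have rts : rt (top s) = rt s by have [] := topP s.
  elim: q (top s) (topTS s erefl) rts pq {uq lq} => [|y q IH] x xT rx /=.
    by move=> _ z; rewrite inE => /eqP->.
  case/andP=> xy pq z; rewrite inE => /orP[/eqP-> //|].
  apply: IH => //; last by rewrite -(Qrt _ _ xy).
  case/existsP: xy => u /existsP[v /and3P[uv /eqP ux /eqP vy]].
  rewrite -vy; apply: topTS; rewrite -rx -ux.
  have [-> _ _] := topP u; apply/esym/(edge_rt fo).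
  by case/andP: uv.
have szq : (size q <= #|F|)%N.
  rewrite -ltnS -[(size q).+1]/(size (top s :: q)); apply: leq_trans cTS.
  by rewrite -(card_uniqP uq); apply: subset_leq_card; apply/subsetP.
have nq : near G (adj_minus G F) ((size q)%:R * (2 * D + r)) (top s) (top t').
  rewrite lq; elim: q (top s) pq {uq lq qTS szq} => [|y q IH] x /=.
    by move=> _; rewrite mul0r; exact: near0.
  case/andP=> xy /IH nq; rewrite -natr1 mulrDl mul1r addrC.
  exact: near_trans (QN _ _ xy) nq.
(* The climb from s and the descent to t' cost at most 2 D together, the extra unit in |F| + 1. *)
have [_ _ ns] := topP s; have [_ _ nt] := topP t'.
apply: near_le (near_trans (near_trans ns nq) (near_sym (adj_sym F) nt)).
have := cg_depth cg s; have := cg_depth cg t'.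
have nn : 0 <= 2 * D + r by rewrite addr_ge0 // mulr_ge0.
have : (size q)%:R * (2 * D + r) <= #|F|%:R * (2 * D + r) by rewrite ler_wpM2r ?ler_nat.
by have := r_ge0; lra.
Qed.

End Detour.
End Instance.

(** * Connectivity labels of one cluster graph *)

Section DfsOrder.
Local Open Scope nat_scope.
Variables (V : finType) (H : rel V) (par rt : V -> V) (rk : V -> nat).
Hypothesis fo : forest H par rt rk.

(* Vertices are inserted by increasing rank, each right after its parent. *)
Lemma dfs_order_closed (A : {set V}) : (forall u, u \in A -> par u \in A) ->
  exists pos lo hi : V -> nat,
    [/\ {in A &, injective pos}, forall u, u \in A -> pos u < #|A|,
        forall v, (lo v <= #|A|) && (hi v <= #|A|) &
        forall u v, u \in A -> (u \in subtree par v) = (lo v <= pos u < hi v)].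
Proof.
have [m] := ubnP #|A|; elim: m A => // m IH A ltA clA.
have [->|[l0 l0A]] := set_0Vmem A.
  by exists (fun=> 0), (fun=> 0), (fun=> 0); split=> [u v|u|v|u v]; rewrite ?inE.
pose l := [arg max_(l > l0 in A) rk l].
have [lA lmax] : l \in A /\ forall u, u \in A -> rk u <= rk l.
  by rewrite /l; case: arg_maxnP => // i iA imax; split.
have leaf u : u \in A -> u != l -> u \notin subtree par l.
  move=> uA ul; apply/negP => /(subtree_rk fo)/(_ ul).
  by rewrite ltnNge lmax.
pose A' := A :\ l.
have cA : #|A| = #|A'|.+1 by rewrite (cardsD1 l A) lA.
have clA' u : u \in A' -> par u \in A'.
  rewrite !inE => /andP[ul uA]; rewrite clA // andbT.
  have [-> //|pu] := eqVneq (par u) u; apply: contraNneq (leaf u uA ul) => <-.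
  by rewrite subtree_par // subtree_self.
have [|pos [lo [hi [pinj plt lohi sub]]]] := IH A' _ clA'; first by rewrite -ltnS -cA.
have A'P u : u \in A -> u != l -> u \in A' by move=> uA ul; rewrite !inE ul.
have [pl|pl] := eqVneq (par l) l.
  exists (fun u => if u == l then #|A'| else pos u),
    (fun v => if v == l then #|A'| else lo v), (fun v => if v == l then #|A'|.+1 else hi v).
  split.
  - move=> u v uA vA; case: (eqVneq u l) => [->|ul]; case: (eqVneq v l) => [->|vl] //.
    + by move=> e; have := plt v (A'P v vA vl); rewrite -e ltnn.
    + by move=> e; have := plt u (A'P u uA ul); rewrite e ltnn.
    + by apply: pinj; exact: A'P.
  - move=> u uA; rewrite cA; case: eqVneq => // ul.
    by rewrite ltnW // ltnS plt // A'P.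
  - by move=> v; rewrite cA; case: eqVneq => // _; have := lohi v; lia.
  - move=> u v uA; case: (eqVneq u l) => [->|ul]; case: (eqVneq v l) => [->|vl].
    + by rewrite subtree_self; lia.
    + by rewrite subtree_root // eq_sym (negbTE vl); have := lohi v; lia.
    + by rewrite (negbTE (leaf u uA ul)); have := plt u (A'P u uA ul); lia.
    + by rewrite sub // A'P.
have pA' : par l \in A' by rewrite !inE pl clA.
pose i := pos (par l).
(* Room is made for [l] right after its parent. Shifting the interval ends as well puts [l] into
   exactly the intervals that contain the parent. *)
pose up j := if j <= i then j else j.+1.
exists (fun u => if u == l then i.+1 else up (pos u)),
  (fun v => if v == l then i.+1 else up (lo v)), (fun v => if v == l then i.+2 else up (hi v)).
have iA' : i < #|A'| by exact: plt.
split.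
- move=> u v uA vA; case: (eqVneq u l) => [->|ul]; case: (eqVneq v l) => [->|vl] //.
  + by rewrite /up; clear; case: ifP; lia.
  + by rewrite /up; clear; case: ifP; lia.
  + move=> e; apply: pinj; rewrite ?A'P //.
    by move: e; rewrite /up; clear; do 2 case: ifP; lia.
- move=> u uA; rewrite cA; case: eqVneq => // ul.
  by have := plt u (A'P u uA ul); rewrite /up; case: ifP; lia.
- move=> v; rewrite cA; case: eqVneq => [_|_]; first by lia.
  by have := lohi v; rewrite /up; do 2 case: ifP; lia.
- move=> u v uA; case: (eqVneq u l) => [->|ul]; case: (eqVneq v l) => [->|vl].
  + by rewrite subtree_self; lia.
  + rewrite subtree_par // sub // -/i /up; clear; do 2 case: ifP; lia.
  + rewrite (negbTE (leaf u uA ul)).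
    by rewrite /up; clear; case: ifP; lia.
  + by rewrite sub ?A'P // /up; clear; do 3 case: ifP; lia.
Qed.

Lemma dfs_order : exists (pos : V -> 'I_#|V|) (vtx : 'I_#|V| -> V)
    (lo hi : V -> 'I_#|V|.+1),
  [/\ cancel pos vtx, cancel vtx pos &
      forall u v, (u \in subtree par v) = (lo v <= pos u < hi v)].
Proof.
have [//|pos [lo [hi [pinj plt lohi sub]]]] := @dfs_order_closed [set: V].
have plt' u : pos u < #|V| by rewrite -cardsT plt.
pose pos' u := Ordinal (plt' u).
have pinj' : injective pos' by move=> u v [] /pinj; apply.
have [|vtx posK vtxK] := inj_card_bij pinj'; first by rewrite card_ord.
exists pos', vtx, (fun v => inord (lo v)), (fun v => inord (hi v)); split=> // u v.
by rewrite !inordK ?ltnS -1?cardsT; have /andP[le1 le2] := lohi v; rewrite ?sub.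
Qed.

End DfsOrder.

Record instance (V : finType) := Instance {
  in_H : rel V;
  in_par : V -> V;
  in_rt : V -> V;
  in_pos : V -> 'I_#|V|;
  in_vtx : 'I_#|V| -> V;
  in_lo : V -> 'I_#|V|.+1;
  in_hi : V -> 'I_#|V|.+1
}.

Record instance_ok (V : finType) (J : instance V) : Prop := InstanceOk {
  ok_forest : exists rk, forest (in_H J) (in_par J) (in_rt J) rk;
  ok_sym : symmetric (in_H J);
  ok_irr : irreflexive (in_H J);
  ok_posK : cancel (in_pos J) (in_vtx J);
  ok_vtxK : cancel (in_vtx J) (in_pos J);
  ok_itv : forall u v,
    (u \in subtree (in_par J) v) = (in_lo J v <= in_pos J u < in_hi J v)%N
}.

Section Entries.
Variables (n L M m : nat).

Definition vert_code : finType :=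
  ('I_n * ('I_n.+1 * 'I_n.+1) * GF m)%type.

(** The tables have one extra round and level, so the index types are nonempty and [inord] applies
    to any natural number. *)
Definition edge_code : finType :=
  ('I_n * 'I_n * ('I_n.+1 * 'I_n.+1) *
   ({ffun 'I_L.+1 * 'I_M.+1 -> GF m} * {ffun 'I_L.+1 * 'I_M.+1 -> GF m}))%type.

Definition itv (lh : 'I_n.+1 * 'I_n.+1) : {set 'I_n} :=
  [set u : 'I_n | (lh.1 <= u < lh.2)%N].

Definition entry_of (e : edge_code) : edge_entry 'I_n (GF m) :=
  EdgeEntry e.1.1.1 e.1.1.2 (itv e.1.2)
    (fun p l => e.2.1 (inord p, inord l)) (fun p l => e.2.2 (inord p, inord l)).

Definition conn_codes (vs vt : vert_code) (es : seq edge_code) : bool :=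
  dec_conn M (edge_tag vs.2) (itv vs.1.2) [seq entry_of e | e <- es] L vs.1.1 vt.1.1.

End Entries.

Lemma connect_homo (T T' : finType) (e : rel T) (e' : rel T') (f : T -> T') (u v : T) :
  connect e u v -> (forall x y, e x y -> e' (f x) (f y)) -> connect e' (f u) (f v).
Proof.
move=> /connectP[p + ->] ef; elim: p u => [|x p IH] u /=; first by rewrite connect0.
by case/andP=> /ef ux /IH; apply: connect_trans; exact: connect1.
Qed.

Section InstanceLabels.
Variables (V : finType) (L M m : nat).
Notation n := #|V|.
Notation smp := {ffun {set V} -> 'I_(2 ^ M)}.
Variables (J : instance V) (t : L.-tuple smp) (w0 : smp) (x : GF m).

Definition J_H : rel 'I_n := relpre (in_vtx J) (in_H J).
Definition J_rt (u : 'I_n) : 'I_n := in_pos J (in_rt J (in_vtx J u)).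
Definition J_par (u : 'I_n) : 'I_n := in_pos J (in_par J (in_vtx J u)).
Definition J_nm (uv : 'I_n * 'I_n) : {set V} := [set in_vtx J uv.1; in_vtx J uv.2].

Definition vert_entry (v : V) : vert_code n m :=
  (in_pos J v, (in_lo J (in_rt J v), in_hi J (in_rt J v)), x).

(** For a tree edge, the interval of its lower end; otherwise [(ord0, ord0)], the empty interval. *)
Definition edge_itv (a b : V) : 'I_n.+1 * 'I_n.+1 :=
  if [pick c | (in_par J c != c) && ([set c; in_par J c] == [set a; b])] is Some c
  then (in_lo J c, in_hi J c) else (ord0, ord0).

Definition edge_entry_code (a b : V) : edge_code n L M m :=
  (in_pos J a, in_pos J b, edge_itv a b,
   ([ffun pl : 'I_L.+1 * 'I_M.+1 => \sum_(u in itv (edge_itv a b))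
      degree_sketch J_H J_nm (edge_tag x) t w0 pl.1 pl.2 u],
    [ffun pl : 'I_L.+1 * 'I_M.+1 => if in_H J a b
      then edge_sketch J_nm (edge_tag x) t w0 pl.1 pl.2 (in_pos J a) (in_pos J b) else 0])).

Definition ends (f : {set V}) : option (V * V) := [pick ab | f == [set ab.1; ab.2]].

Lemma endsP (f : {set V}) : (#|f| = 2)%N -> exists a b, ends f = Some (a, b) /\ f = [set a; b].
Proof.
move/eqP/cards2P => [a [b [_ fE]]]; rewrite /ends; case: pickP => [[a' b'] /= /eqP fE'|/(_ (a, b))].
  by exists a', b'.
by rewrite /= fE eqxx.
Qed.

Definition edge_set (f : {set V}) : {set 'I_n} :=
  if ends f is Some (a, b) then itv (edge_itv a b) else set0.

Hypothesis ok : instance_ok J.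

Let posK := ok_posK ok.
Let vtxK := ok_vtxK ok.

Lemma J_forest : exists rk, forest J_H J_par J_rt rk.
Proof.
have [rk fo] := ok_forest ok; exists (rk \o in_vtx J).
have parE u : (J_par u != u) = (in_par J (in_vtx J u) != in_vtx J u).
  by rewrite -(inj_eq (can_inj vtxK)) /J_par posK.
split=> [u|u|u|u|u v].
- by rewrite parE /= /J_par posK; exact: par_rk fo _.
- by rewrite parE /J_H /= /J_par posK; exact: par_edge fo _.
- by rewrite /J_rt /J_par posK (rt_par fo).
- move=> pu; have {}pu : in_par J (in_vtx J u) = in_vtx J u by rewrite -{2}pu /J_par posK.
  by rewrite /J_rt (rt_root fo pu) vtxK.
- by rewrite /J_H /J_rt /= => /(edge_rt fo) ->.
Qed.

Lemma J_subtree u c : (u \in subtree J_par c) = (in_vtx J u \in subtree (in_par J) (in_vtx J c)).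
Proof.
have [rk fo] := ok_forest ok; have [rk' fo'] := J_forest.
elim/(forest_ind fo'): u => u pu.
  rewrite !subtree_root ?(inj_eq (can_inj vtxK)) //.
  by rewrite -{2}pu /J_par posK.
move=> IH; have [->|cu] := eqVneq c u; first by rewrite !subtree_self.
rewrite subtree_par // IH [RHS]subtree_par ?(inj_eq (can_inj vtxK)) //.
by rewrite /J_par posK.
Qed.

Lemma J_itv c : itv (in_lo J (in_vtx J c), in_hi J (in_vtx J c)) = subtree J_par c.
Proof. by apply/setP=> u; rewrite inE J_subtree (ok_itv ok) vtxK. Qed.

Lemma set2_eq (a b c d : V) : [set a; b] = [set c; d] ->
  (c, d) = (a, b) \/ (c, d) = (b, a).
Proof.
move=> e.
have ha : a = c \/ a = d by apply/set2P; rewrite -e set21.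
have hb : b = c \/ b = d by apply/set2P; rewrite -e set22.
have hc : c = a \/ c = b by apply/set2P; rewrite e set21.
have hd : d = a \/ d = b by apply/set2P; rewrite e set22.
by case: ha => ?; case: hb => ?; case: hc => ?; case: hd => ?; subst; auto.
Qed.

Section Query.
Variables (s s' : V) (F : {set {set V}}) (Fs : seq {set V}).
Hypothesis Fs_perm : perm_eq Fs (enum F).
Hypothesis F_card : forall f : {set V}, f \in F -> (#|f| = 2)%N.

Definition query_K : {set 'I_n} := [set u | J_rt u == J_rt (in_pos J s)].
Definition query_base : rel 'I_n := same query_K [seq edge_set f | f <- Fs].
Definition query_H : rel 'I_n := [rel u v | J_H u v && (J_nm (u, v) \notin Fs)].

Lemma conn_codes_correct :
  ~ bad_seed query_base query_H query_K J_nm t w0 (edge_tag x) ->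
  alive query_base query_H query_K
    (foldl (ideal_step query_base query_H query_K J_nm) set0 t) = set0 ->
  conn_codes (vert_entry s) (vert_entry s')
    [seq (if ends f is Some (a, b) then edge_entry_code a b else edge_entry_code s s) | f <- Fs] =
  connect [rel u v | in_H J u v && ([set u; v] \notin F)] s s'.
Proof.
move=> nbad al0.
have [rk fo] := J_forest; have [rkV foV] := ok_forest ok.
pose g f := if ends f is Some (a, b) then edge_entry_code a b else edge_entry_code s s.
pose ent f := entry_of (g f).
have FsF f : (f \in Fs) = (f \in F) by rewrite (perm_mem Fs_perm) mem_enum.
have Fends f : f \in Fs -> exists a b,
    [/\ f = [set a; b], ends f = Some (a, b) & ent f = entry_of (edge_entry_code a b)].
  rewrite FsF => /F_card /endsP[a [b [eE fE]]]; exists a, b; split=> //.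
  by rewrite /ent /g eE.
have DsE : [seq eD (ent f) | f <- Fs] = [seq edge_set f | f <- Fs].
  apply/eq_in_map=> f /Fends[a [b [_ eE ->]]]; by rewrite /edge_set eE.
have nm_sym u v : J_nm (u, v) = J_nm (v, u) by rewrite /J_nm /= setUC.
have KE : itv (in_lo J (in_rt J s), in_hi J (in_rt J s)) = query_K.
  rewrite -{1 2}[in_rt J s]posK J_itv; apply/setP=> u.
  by rewrite [RHS]inE -(subtree_rtE fo) /J_rt posK.
have childE c : in_par J c != c -> [pick c' | (in_par J c' != c') &&
    ([set c'; in_par J c'] == [set c; in_par J c])] = Some c.
  move=> pc; case: pickP => [c' /andP[pc' /eqP/set2_eq[[-> _ //]|[e1 e2]]]|/(_ c)].
    have := par_rk foV pc; have := par_rk foV pc'; rewrite e2 -e1; lia.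
  by rewrite pc eqxx.
have parE c : (J_par c != c) = (in_par J (in_vtx J c) != in_vtx J c).
  by rewrite -(inj_eq (can_inj vtxK)) /J_par posK.
have nmE c : J_nm (c, J_par c) = [set in_vtx J c; in_par J (in_vtx J c)].
  by rewrite /J_nm /= /J_par posK.
rewrite /conn_codes /= KE -map_comp.
rewrite (_ : [seq _ | f <- Fs] = [seq ent f | f <- Fs]) //.
have := @dec_connE _ _ _ M L J_H J_par J_rt rk J_nm Fs ent (edge_tag x) t w0 (in_pos J s).
rewrite DsE => dE; rewrite dE {dE}.
- have eqF a b : (J_nm (in_pos J a, in_pos J b) \notin Fs) = ([set a; b] \notin F).
    by rewrite /J_nm /= !posK FsF.
  apply/idP/idP => [|/(connect_homo (f := in_pos J))]; last first.
    by apply=> u v /andP[uv uF]; rewrite /= eqF uF /J_H /= !posK uv.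
  move/(connect_homo (f := in_vtx J) (e' := [rel u v | in_H J u v && ([set u; v] \notin F)])).
  rewrite !posK; apply=> u v /andP[uv uF].
  by move: uF; rewrite -{1}[u]vtxK -{1}[v]vtxK eqF /= => ->; rewrite andbT.
- exact: GF_addxx.
- exact: fo.
- by move=> u v; rewrite /J_H /= (ok_sym ok).
- by move=> u; rewrite /J_H /= (ok_irr ok).
- exact: nm_sym.
- move=> u v y z /set2_eq /= [[e1 e2]|[e1 e2]]; [left|right];
    by rewrite -[y]vtxK -[z]vtxK e1 e2 !vtxK.
- exact: edge_tag_sym.
- by rewrite (perm_uniq Fs_perm) enum_uniq.
- move=> c pc cF; have [a [b [fE _ ->]]] := Fends _ cF; rewrite /= /edge_itv.
  by rewrite -fE nmE childE -?parE // -J_itv.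
- move=> f fF no; have [a [b [fE _ ->]]] := Fends _ fF; rewrite /= /edge_itv -fE.
  case: pickP => [c /andP[pc /eqP cf]|_]; last by apply/setP=> u; rewrite !inE andbC.
  have := no (in_pos J c); rewrite parE nmE !posK => /(_ pc).
  by rewrite cf eqxx.
- move=> f p l fF pL lM; have [a [b [_ _ ->]]] := Fends _ fF.
  by rewrite /= ffunE /= !inordK // ltnW.
- move=> f u v fF Huv nuv; have [a [b [fE _ ->]]] := Fends _ fF => /=.
  have /set2_eq[[-> ->]|[-> ->]] : [set in_vtx J u; in_vtx J v] = [set a; b] by rewrite -fE -nuv.
    by left; rewrite !vtxK.
  by right; rewrite !vtxK.
- move=> f u v p l fF Huv nuv pL lM; have [a [b [fE _ ->]]] := Fends _ fF => /=.
  rewrite ffunE /= !inordK 1?ltnW //; move: Huv; rewrite /J_H /= => Huv.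
  have /set2_eq[[-> ->]|[-> ->]] : [set in_vtx J u; in_vtx J v] = [set a; b] by rewrite -fE -nuv.
    by rewrite Huv !vtxK.
  by rewrite (ok_sym ok) Huv !vtxK /edge_sketch nm_sym edge_tag_sym.
- move=> f p l fF pL lM no; have [a [b [fE _ ->]]] := Fends _ fF => /=.
  rewrite ffunE /=; case: ifP => // Hab.
  have := no (in_pos J a) (in_pos J b); rewrite /J_H /= !posK => /(_ Hab).
  by rewrite /J_nm /= !posK fE eqxx.
- exact: nbad.
- exact: al0.
Qed.

End Query.
End InstanceLabels.

(** * Distance labels *)

Section LabelParams.
Local Open Scope nat_scope.
Variables (e n : nat).

Definition log_size := (trunc_log 2 n).+1.
(** Large enough for [card_levels], so that isolation applies to every cut. *)
Definition num_levels := 2 * log_size + 2.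
(* As (15/16)^16 <= 1/2, this many rounds leave an unfinished block with probability
   at most n 2^(- e log n). *)
Definition num_rounds := 16 * (e * log_size).
(** Large enough that, by [seed_bound], bad field elements are rarer than n^(1-e). *)
Definition field_log := (2 * e + 20) * log_size.
Definition entry_bits := 4 * log_size + 2 * (field_log.+1 * (num_rounds.+1 * num_levels.+1)).

Lemma lt_log_size : n < 2 ^ log_size.
Proof. exact: trunc_log_ltn. Qed.

Lemma card_vert_code : #|vert_code n field_log| <= 2 ^ entry_bits.
Proof.
rewrite !card_prod !card_ord card_GF; have lt := lt_log_size.
apply: (@leq_trans (2 ^ log_size * (2 ^ log_size * 2 ^ log_size) * 2 ^ field_log.+1)).
  by rewrite leq_mul // ?leq_mul // ltnW.
by rewrite -!expnD leq_exp2l // /entry_bits; nia.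
Qed.

Lemma card_edge_code : #|edge_code n num_rounds num_levels field_log| <= 2 ^ entry_bits.
Proof.
rewrite !card_prod !card_ffun !card_prod !card_ord card_GF; have lt := lt_log_size.
rewrite -!expnM.
apply: (@leq_trans (2 ^ log_size * 2 ^ log_size * (2 ^ log_size * 2 ^ log_size) *
  (2 ^ (field_log.+1 * (num_rounds.+1 * num_levels.+1)) *
   2 ^ (field_log.+1 * (num_rounds.+1 * num_levels.+1))))).
  by rewrite leq_mul // !leq_mul // ltnW.
by rewrite -!expnD leq_exp2l // /entry_bits; lia.
Qed.

End LabelParams.

Arguments log_size : simpl never.

Section DistanceDecoder.
Variables (R : realType) (e : nat).

Definition body (b : bitseq) : seq (seq bitseq) := [seq parse w | w <- parse b].

Definition word (b : bitseq) (i p : nat) : bitseq := nth [::] (nth [::] (body b) i) p.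

Definition claim (n : nat) (bs bt : bitseq) (bF : seq bitseq) (i p : nat) : bool :=
  match decode (vert_code n (field_log e n)) (entry_bits e n) (word bs i p),
        decode (vert_code n (field_log e n)) (entry_bits e n) (word bt i p) with
  | Some vs, Some vt => conn_codes vs vt
      (pmap (fun f => decode (edge_code n (num_rounds e n) (num_levels n) (field_log e n))
                             (entry_bits e n) (word f i p)) bF)
  | _, _ => false
  end.

Definition scale_claims (n : nat) (bs bt : bitseq) (bF : seq bitseq) : seq bool :=
  [seq has (claim n bs bt bF i) (iota 0 (size (nth [::] (body bs) i)))
     | i <- iota 0 (size (body bs))].

(** One decoder serves all graphs, so n and k are read from the label, k in unary. Vertex labels
    contain the index of the vertex, hence equal labels mean s = t. *)
Definition dist_dec : decoder R := fun bs bt bF =>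
  if bs == bt then 0%E else
  let hs := parse bs in
  let n := nat_of_bits (nth [::] hs 1) in
  let k := size (nth [::] hs 2) in
  let cs := scale_claims n (nth [::] hs 3) (nth [::] (parse bt) 3) bF in
  if has id cs
  then ((4 * k%:R - 1) * ((size bF)%:R + 1) * 2 ^+ (find id cs))%:E else +oo%E.

Section Labels.
Variables (V : finType) (S : nat) (P : nat -> nat) (J : nat -> nat -> instance V) (k : nat).
Notation n := #|V|.
Notation L := (num_rounds e n).
Notation M := (num_levels n).
Notation smp := {ffun {set V} -> 'I_(2 ^ M)}.
Variables (w0 : smp) (om : L.-tuple smp * GF (field_log e n)).

Definition mk_body (ent : nat -> nat -> bitseq) : bitseq :=
  enc_seq [seq enc_seq [seq ent i p | p <- iota 0 (P i)] | i <- iota 0 S].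

Lemma body_mk ent : body (mk_body ent) = [seq [seq ent i p | p <- iota 0 (P i)] | i <- iota 0 S].
Proof.
by rewrite /body /mk_body enc_seqK -map_comp; apply: eq_map => i /=; rewrite enc_seqK.
Qed.

Lemma nth_body_mk ent i : (i < S)%N ->
  nth [::] (body (mk_body ent)) i = [seq ent i p | p <- iota 0 (P i)].
Proof. by move=> iS; rewrite body_mk (nth_map 0%N) ?size_iota // nth_iota. Qed.

Lemma word_mk ent i p : (i < S)%N -> (p < P i)%N -> word (mk_body ent) i p = ent i p.
Proof.
by move=> iS pP; rewrite /word nth_body_mk // (nth_map 0%N) ?size_iota // nth_iota.
Qed.

Definition vert_body (v : V) : bitseq :=
  mk_body (fun i p => code (entry_bits e n) (vert_entry (J i p) om.2 v)).

Definition vert_label (v : V) : bitseq :=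
  enc_seq [:: bits (log_size n) (enum_rank v); bits (log_size n) n; nseq k true; vert_body v].

Definition edge_label (f : {set V}) : bitseq :=
  mk_body (fun i p => if ends f is Some (a, b)
    then code (entry_bits e n) (edge_entry_code (J i p) om.1 w0 om.2 a b) else [::]).

Lemma vert_label_inj : injective vert_label.
Proof.
move=> u v /(can_inj enc_seqK) /(congr1 (fun s => nat_of_bits (nth [::] s 0))).
rewrite !bitsK ?(ltn_trans (ltn_ord _) (lt_log_size _)) // => /val_inj.
exact: enum_rank_inj.
Qed.

Lemma pmap_some (T T1 T2 : eqType) (g : T1 -> option T2) (l : T -> T1) (h : T -> T2) (fs : seq T) :
  (forall f, f \in fs -> g (l f) = Some (h f)) -> pmap g (map l fs) = map h fs.
Proof.
elim: fs => [|f fs IH] //= gh; rewrite gh ?mem_head //= IH // => x xfs.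
by apply: gh; rewrite inE xfs orbT.
Qed.

Lemma claim_labels s s' (Fs : seq {set V}) i p : (i < S)%N -> (p < P i)%N ->
  (forall f : {set V}, f \in Fs -> #|f| = 2%N) ->
  claim n (vert_body s) (vert_body s') (map edge_label Fs) i p =
  conn_codes (vert_entry (J i p) om.2 s) (vert_entry (J i p) om.2 s')
    [seq (if ends f is Some (a, b) then edge_entry_code (J i p) om.1 w0 om.2 a b
          else edge_entry_code (J i p) om.1 w0 om.2 s s) | f <- Fs].
Proof.
move=> iS pP F2; rewrite /claim (word_mk _ iS pP) (word_mk _ iS pP).
rewrite (codeK _ (card_vert_code e n)) (codeK _ (card_vert_code e n)).
congr (conn_codes _ _ _); apply: pmap_some => f fF; rewrite (word_mk _ iS pP).
have [a [b [-> _]]] := endsP (F2 f fF).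
exact: codeK (card_edge_code e n).
Qed.

Lemma size_mk_body ent Pm : (forall i, (i < S)%N -> (P i <= Pm)%N) ->
  (forall i p, (size (ent i p) <= entry_bits e n)%N) ->
  (size (mk_body ent) <= S * (2 * (Pm * (2 * entry_bits e n).+1)).+1)%N.
Proof.
move=> PPm le; apply: leq_trans (size_enc_seq_le (B := Pm * (2 * entry_bits e n).+1) _) _.
  move=> w /mapP[i]; rewrite mem_iota add0n => iS ->.
  apply: leq_trans (size_enc_seq_le (B := entry_bits e n) _) _; last first.
    by rewrite size_map size_iota leq_mul2r PPm ?orbT.
  by move=> w' /mapP[p _ ->].
by rewrite size_map size_iota.
Qed.

Lemma size_vert_label v Pm : (forall i, (i < S)%N -> (P i <= Pm)%N) ->
  (size (vert_label v) <= 4 * log_size n + 2 * k + 4 +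
     2 * (S * (2 * (Pm * (2 * entry_bits e n).+1)).+1))%N.
Proof.
move=> PPm; have := @size_mk_body (fun i p => code (entry_bits e n) (vert_entry (J i p) om.2 v)) Pm PPm.
move=> /(_ _)/wrap[|]; first by move=> i p; rewrite size_bits.
rewrite /vert_label !size_enc_seq_cons !size_bits size_nseq -/(vert_body v) /=.
by move: (size _) (S * _)%N => a b; lia.
Qed.

Lemma size_edge_label f Pm : (forall i, (i < S)%N -> (P i <= Pm)%N) ->
  (size (edge_label f) <= S * (2 * (Pm * (2 * entry_bits e n).+1)).+1)%N.
Proof.
move=> PPm; apply: size_mk_body => // i p.
by case: ends => [[a b]|] //; rewrite size_bits.
Qed.

Lemma dist_decE s s' (Fs : seq {set V}) :
  dist_dec (vert_label s) (vert_label s') (map edge_label Fs) =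
  if s == s' then 0%E else
  let cs := [seq has (claim n (vert_body s) (vert_body s') (map edge_label Fs) i) (iota 0 (P i))
               | i <- iota 0 S] in
  if has id cs
  then ((4 * k%:R - 1) * ((size Fs)%:R + 1) * 2 ^+ (find id cs))%:E else +oo%E.
Proof.
have body3 v : nth [::] (parse (vert_label v)) 3 = vert_body v by rewrite enc_seqK.
have nE : nat_of_bits (nth [::] (parse (vert_label s)) 1) = n.
  by rewrite enc_seqK; exact: bitsK (lt_log_size n).
have kE : size (nth [::] (parse (vert_label s)) 2) = k.
  by rewrite enc_seqK; exact: size_nseq.
rewrite /dist_dec (inj_eq vert_label_inj); case: eqP => // _; cbv zeta.
rewrite !body3 nE kE size_map.
rewrite (_ : scale_claims _ _ _ _ = [seq has (claim n (vert_body s) (vert_body s')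
  (map edge_label Fs) i) (iota 0 (P i)) | i <- iota 0 S]) //.
rewrite /scale_claims [in size (body _)]body_mk size_map size_iota.
apply/eq_in_map=> i; rewrite mem_iota add0n => iS.
by rewrite nth_body_mk // size_map size_iota.
Qed.

End Labels.
End DistanceDecoder.

(** * Distance scales *)

Section Scales.
Variables (R : realType) (V : finType) (G : wgraph R V) (k : nat).
Hypothesis weight_ge1 : forall e, e \in edges G -> 1 <= weight G e.
Hypothesis k_gt0 : (0 < k)%N.

Definition survive (J : instance V) (F : {set {set V}}) : rel V :=
  [rel u v | in_H J u v && ([set u; v] \notin F)].

Lemma instance_exists : exists J : instance V, True.
Proof.
have fo : forest (fun _ _ : V => false) id id (fun=> 0%N) by split=> // u; rewrite eqxx.
have [pos [vtx [lo [hi _]]]] := dfs_order fo.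
by exists (Instance (fun _ _ => false) id id pos vtx lo hi).
Qed.

Lemma scale_instances (rho : R) : 0 <= rho ->
  exists P (J : nat -> instance V), [/\
    P%:R <= k%:R * kroot R k #|V|, (P <= #|V|)%N,
    forall p, (p < P)%N -> instance_ok (J p),
    forall p F s t, (p < P)%N -> connect (survive (J p) F) s t ->
      near G (adj_minus G F) ((4 * k%:R - 1) * (#|F|%:R + 1) * rho) s t &
    forall s, exists2 p, (p < P)%N & forall F t, near G (adj_minus G F) rho s t ->
      connect (survive (J p) F) s t].
Proof.
move=> rho0; have [J0 _] := instance_exists.
have [P [A [ctr [h [cl cov Pk PV]]]]] := cover_phases R (balls_meet_refl G rho0)
  (balls_meet_sym G rho) k_gt0 [set: V].
rewrite cardsT in Pk PV.
have exJ p : exists J, (p < P)%N -> [/\ instance_ok J,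
    forall F s t, connect (survive J F) s t ->
      near G (adj_minus G F) ((4 * k%:R - 1) * (#|F|%:R + 1) * rho) s t &
    forall s, s \in A p -> forall F t, near G (adj_minus G F) rho s t -> connect (survive J F) s t].
  have [pP|pP] := boolP (p < P)%N; last by exists J0.
  have [H [par [rt [rk [dp [cg cvr]]]]]] := phase_graph weight_ge1 rho0 (cl p pP) k_gt0.
  have [pos [vtx [lo [hi [pK vK itvE]]]]] := dfs_order (cg_forest cg).
  exists (Instance H par rt pos vtx lo hi) => _; split.
  - split=> //=; [by exists rk; exact: cg_forest cg|exact: cg_sym cg|].
    by apply: edge_irr; exact: cg_edge cg.
  - move=> F s t; rewrite /survive /= => c.
    have D0 : 0 <= (2 * k%:R - 1) * rho by exact: D_ge0.
    apply: near_le (detour cg rho0 D0 c).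
    (* With D = (2k-1) rho, the detour unit 2 D + rho is (4k-1) rho. *)
    by rewrite le_eqVlt; apply/orP; left; apply/eqP; ring.
  - exact: cvr.
have [J JP] := choice exJ.
exists P, J; split=> // [p|p F s t|s].
- by case/JP.
- by case/JP=> _ + _; apply.
- have [|p pP sA] := cov s; first by rewrite inE.
  by exists p => //; have [_ _] := JP p pP; apply.
Qed.

Definition relevant (i : nat) : bool :=
  [exists ab : V * V, ([set ab.1; ab.2] \in edges G) &&
    (weight G [set ab.1; ab.2] <= 2 ^+ i < 2 * #|V|%:R * weight G [set ab.1; ab.2])].

Lemma heaviest_edge (e : rel V) u p : on_edges G e -> path e u p -> p != [::] ->
  exists a b, [/\ e a b, weight G [set a; b] <= walk_weight G u p &
    path [rel x y | e x y && (weight G [set x; y] <= weight G [set a; b])] u p].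
Proof.
move=> eG; elim: p u => [|x p IH] u //= /andP[ux pp] _.
have [p0|p0] := eqVneq p [::].
  by exists u, x; rewrite p0 /= addr0 ux lexx.
have [a [b [ab wab pab]]] := IH x pp p0.
have w0 := le_trans ler01 (weight_ge1 (eG _ _ ux)).
have [le|/ltW ge] := leP (weight G [set u; x]) (weight G [set a; b]).
  by exists a, b; rewrite ab ux le pab (le_trans wab) ?lerDr.
exists u, x; rewrite ux lexx /= lerDl (walk_weight_ge0 weight_ge1 eG pp); split=> //.
by apply: sub_path pab => y z /andP[/= -> /le_trans]; apply.
Qed.

(** A shortest walk can be taken without repeated vertices, so its weight d lies between w and n w
    for its heaviest edge weight w. The least power of 2 above d is either 1 or less than 2d, so
    this edge witnesses relevance. *)
Lemma min_walk_relevant F s t p i : path (adj_minus G F) s p -> last s p = t -> s != t ->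
  (forall q, path (adj_minus G F) s q -> last s q = t -> walk_weight G s p <= walk_weight G s q) ->
  walk_weight G s p <= 2 ^+ i -> (forall j, walk_weight G s p <= 2 ^+ j -> (i <= j)%N) ->
  relevant i.
Proof.
move=> pp lp st mn di imin; have eG := @adj_on_edges _ _ G F.
have p0 : p != [::] by apply: contraNneq st => p0; rewrite -lp p0.
have [a [b [ab wab pab]]] := heaviest_edge eG pp p0.
set w := weight G [set a; b] in wab pab.
have w1 : 1 <= w by exact: weight_ge1 (eG _ _ ab).
have dn : walk_weight G s p <= #|V|%:R * w.
  case/shortenP: pab lp => q pq uq _ lq.
  have pq' : path (adj_minus G F) s q by apply: sub_path pq => x y /andP[].
  apply: le_trans (mn q pq' lq) _; apply: (@le_trans _ _ ((size q)%:R * w)).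
    elim: q s pq {mn pp st di imin p p0 wab uq lq pq'} => [|x q IH] s /=; first by rewrite mul0r.
    by case/andP=> /andP[_ sx] /IH le; rewrite -natr1 mulrDl mul1r addrC lerD.
  rewrite ler_wpM2r ?(le_trans ler01) // ler_nat ltnW //.
  by rewrite -[X in (X <= _)%N]/(size (s :: q)) -(card_uniqP uq) max_card.
apply/existsP; exists (a, b); rewrite /= (eG _ _ ab) /= -/w (le_trans wab di) /=.
have n1 : 1 <= #|V|%:R :> R by rewrite ler1n; apply/card_gt0P; exists s.
case: i di imin => [|i] di imin; first by rewrite expr0; nra.
have lt : 2 ^+ i < walk_weight G s p by rewrite ltNge; apply/negP => /imin; rewrite ltnn.
by rewrite exprS -mulrA ltr_pM2l // (lt_le_trans lt).
Qed.

Lemma dist_min_walk F s t p : path (adj_minus G F) s p -> last s p = t ->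
  (forall q, path (adj_minus G F) s q -> last s q = t -> walk_weight G s p <= walk_weight G s q) ->
  dist G F s t = (walk_weight G s p)%:E.
Proof.
move=> pp lp mn; apply/eqP; rewrite eq_le; apply/andP; split.
  by apply: ereal_inf_lbound; exists p.
by apply/ereal_infP => _ [q [pq lq] <-]; rewrite lee_fin mn.
Qed.

Lemma dist_near F s t r : near G (adj_minus G F) r s t -> (dist G F s t <= r%:E)%E.
Proof.
case=> p [pp lp wp]; apply: (@le_trans _ _ (walk_weight G s p)%:E); last by rewrite lee_fin.
by apply: ereal_inf_lbound; exists p.
Qed.

Lemma dist_unreachable F s t : ~~ connect (adj_minus G F) s t -> dist G F s t = +oo%E.
Proof.
move=> nc; apply/ereal_inf_pinfty => _ [p [pp lp] <-].
by case/negP: nc; apply/connectP; exists p.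
Qed.

Lemma dist_refl F s : dist G F s s = 0%E.
Proof.
by rewrite (@dist_min_walk _ _ _ [::]) // => q pq _; exact: walk_weight_ge0 (@adj_on_edges _ _ G F) pq.
Qed.

(** The deterministic part, given correct claims. A claim at any scale yields a real detour, so an
    early hit is harmless; the least 2^i >= d is relevant and below 2d (or equal to 1), so the first
    hit is not too late. *)
Lemma estimate_correct (S : nat) (P : nat -> nat) (J : nat -> nat -> instance V)
    (cs : seq bool) (F : {set {set V}}) (s t : V) :
  s != t ->
  (forall i p F' u v, (p < P i)%N -> connect (survive (J i p) F') u v ->
      near G (adj_minus G F') ((4 * k%:R - 1) * (#|F'|%:R + 1) * 2 ^+ i) u v) ->
  (forall i u, relevant i -> exists2 p, (p < P i)%N &
    forall F' v, near G (adj_minus G F') (2 ^+ i) u v -> connect (survive (J i p) F') u v) ->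
  (forall i, relevant i -> (i < S)%N) ->
  size cs = S ->
  (forall i, (i < S)%N -> nth false cs i =
    has (fun p => connect (survive (J i p) F) s t) (iota 0 (P i))) ->
  good_estimate G (fun m : nat => (8 * k%:R - 2) * (m%:R + 1)) s t F
    (if has id cs then ((4 * k%:R - 1) * (#|F|%:R + 1) * 2 ^+ (find id cs))%:E else +oo%E).
Proof.
move=> st sound cover relS szcs csE; apply/andP; split.
  case: ifP => [hcs|_]; last exact: leey.
  have fS : (find id cs < S)%N by rewrite -szcs -has_find.
  have := nth_find false hcs; rewrite csE // => /hasP[p]; rewrite mem_iota add0n => pP c.
  exact/dist_near/(sound _ _ _ _ _ pP c).
have k1 : 1 <= k%:R :> R by rewrite ler1n.
have F0 : 0 <= #|F|%:R :> R by [].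
have [conn|nconn] := boolP (connect (adj_minus G F) s t); last first.
  rewrite dist_unreachable // gt0_muley ?leey // lte_fin mulr_gt0 //; lra.
have eG := @adj_on_edges _ _ G F.
have [p [pp lp mn]] := min_walk weight_ge1 eG conn.
rewrite (dist_min_walk pp lp mn); set d := walk_weight G s p in mn *.
have d1 : 1 <= d.
  apply: le_trans (walk_weight_size weight_ge1 eG pp).
  by rewrite ler1n lt0n size_eq0; apply: contraNneq st => p0; rewrite -lp p0.
have exi : exists i, d <= 2 ^+ i.
  exists (Num.bound d); rewrite ltW //; exact: upper_nthrootP.
pose i := ex_minn exi.
have [di imin] : d <= 2 ^+ i /\ forall j, d <= 2 ^+ j -> (i <= j)%N.
  by rewrite /i; case: ex_minnP.
have ri : relevant i by exact: min_walk_relevant pp lp st mn di imin.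
have iS := relS _ ri; have [q qP qc] := cover i s ri.
have ci : nth false cs i.
  rewrite csE //; apply/hasP; exists q; first by rewrite mem_iota.
  by apply: qc; exists p.
have hcs : has id cs by apply/(has_nthP false); exists i; rewrite ?szcs.
rewrite hcs -EFinM lee_fin.
have fi : (find id cs <= i)%N.
  by rewrite leqNgt; apply/negP => /(before_find false); rewrite ci.
have i2 : 2 ^+ i <= 2 * d.
  case: (i) imin => [|j] imin; first by rewrite expr0; lra.
  rewrite exprS ler_pM2l // ltW // ltNge; apply/negP => /imin; by rewrite ltnn.
have f2 : 2 ^+ find id cs <= 2 * d.
  by apply: le_trans i2; rewrite ler_eXn2l ?ltr1n.
rewrite (_ : (8 * _ - 2) * _ * d = (4 * k%:R - 1) * (#|F|%:R + 1) * (2 * d)); last by ring.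
rewrite ler_wpM2l // mulr_ge0 //; lra.
Qed.

(** The window has ratio 2n, so two exponents in it differ by less than log(2n), rounded up; this
    does not depend on S. *)
Lemma card_relevant_scales (S : nat) (w : R) : 0 < w ->
  (#|[set i : 'I_S | (w <= 2 ^+ i < 2 * #|V|%:R * w)%R]| <= (log_size #|V|).+1)%N.
Proof.
move=> w0; set B := [set i | _].
have [->|[i1 i1B]] := set_0Vmem B; first by rewrite cards0.
pose i0 := [arg min_(i < i1 in B) (i : nat)].
have [i0B imin] : i0 \in B /\ forall i, i \in B -> (i0 <= i)%N.
  by rewrite /i0; case: arg_minnP => // j jB jmin; split.
have ilt i : i \in B -> (i - i0 < (log_size #|V|).+1)%N.
  move=> iB; have le := imin i iB; move: iB i0B; rewrite !inE => /andP[_ hi] /andP[lo _].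
  rewrite -(@ltn_exp2l 2) // -(ltr_nat R) natrX.
  apply: (@lt_trans _ _ (2 * #|V|%:R)); last first.
    by rewrite expnS natrM ltr_pM2l // ltr_nat lt_log_size.
  rewrite -(ltr_pM2r w0); apply: le_lt_trans hi.
  rewrite -[X in _ <= _ ^+ X](subnK le) exprD ler_wpM2l // exprn_ge0 //.
have inj : {in B &, injective (fun i : 'I_S => inord (i - i0) : 'I_(log_size #|V|).+1)}.
  move=> i j iB jB /(congr1 val) /=; rewrite !inordK ?ilt // => e; apply: val_inj => /=.
  by have := imin i iB; have := imin j jB; lia.
by rewrite -(card_in_imset inj) (leq_trans (max_card _)) // card_ord.
Qed.

Lemma card_relevant (S : nat) :
  (#|[set i : 'I_S | relevant i]| <= #|V| * #|V| * (log_size #|V|).+1)%N.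
Proof.
pose T (ab : V * V) := if [set ab.1; ab.2] \in edges G then
  [set i : 'I_S | weight G [set ab.1; ab.2] <= 2 ^+ i < 2 * #|V|%:R * weight G [set ab.1; ab.2]]
  else set0.
have sub : [set i : 'I_S | relevant i] \subset \bigcup_ab T ab.
  apply/subsetP=> i; rewrite inE => /existsP[ab /andP[abE hw]].
  by apply/bigcupP; exists ab => //; rewrite /T abE inE.
apply: leq_trans (subset_leq_card sub) _.
apply: (@leq_trans (\sum_ab #|T ab|)).
  elim/big_ind2: _ => [|X a Y b le1 le2|//]; first by rewrite cards0.
  by apply: leq_trans (leq_add le1 le2); rewrite -cardsUI leq_addr.
apply: (@leq_trans (\sum_(ab : V * V) (log_size #|V|).+1)%N).
  apply: leq_sum => ab _; rewrite /T; case: ifP => [abE|_]; last by rewrite cards0.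
  apply: card_relevant_scales; exact: lt_le_trans ltr01 (weight_ge1 abE).
by rewrite sum_nat_const card_prod.
Qed.

End Scales.

(** * Failure probability *)

Section Failure.
Local Open Scope nat_scope.

(** If (a/b)^r <= 1/2, then r q decay steps gain a factor 2^q. *)
Lemma decay_cancel (a b r q X Y : nat) : 0 < a -> 2 * a ^ r <= b ^ r ->
  b ^ (r * q) * X <= a ^ (r * q) * Y -> 2 ^ q * X <= Y.
Proof.
move=> a0 ab le; have h : 2 ^ q * a ^ (r * q) <= b ^ (r * q).
  by rewrite !expnM -expnMn; case: q le => // q _; rewrite leq_exp2r.
rewrite -(@leq_pmul2l (a ^ (r * q))) ?expn_gt0 ?a0 //; apply: leq_trans le.
by rewrite mulnA leq_mul2r [a ^ _ * _]mulnC h orbT.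
Qed.

Lemma pow_15_16 : 2 * 15 ^ 16 <= 16 ^ 16.
Proof. lia. Qed.

Variables (V : finType) (e : nat) (J : instance V) (s : V) (Fs : seq {set V}).
Notation n := #|V|.
Notation L := (num_rounds e n).
Notation M := (num_levels n).
Notation m := (field_log e n).
Notation smp := {ffun {set V} -> 'I_(2 ^ M)}.
Variable w0 : smp.

Definition failures : {set L.-tuple smp * GF m} :=
  [set om : L.-tuple smp * GF m | (alive (query_base J s Fs) (query_H J Fs) (query_K J s)
      (foldl (ideal_step (query_base J s Fs) (query_H J Fs) (query_K J s) (J_nm J)) set0 om.1) != set0) ||
    `[< bad_seed (query_base J s Fs) (query_H J Fs) (query_K J s) (J_nm J) om.1 w0 (edge_tag om.2) >]].

Hypothesis ok : instance_ok J.
Hypothesis n_gt1 : 1 < n.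
Hypothesis e_gt1 : 1 < e.

Lemma log_size_le : log_size n <= n.
Proof.
rewrite /log_size; apply: leq_trans (@trunc_logP 2 n isT (ltnW n_gt1)).
exact: ltn_expl.
Qed.

Lemma card_levels : n * n < 2 ^ M.-1.
Proof.
have lt := lt_log_size n; apply: (@leq_trans (2 ^ log_size n * 2 ^ log_size n)).
  by apply: ltn_mul.
by rewrite -expnD leq_exp2l // /num_levels; lia.
Qed.

Lemma seed_bound : n ^ e.-1 * (L * n * M * (n * n) * (n * n)) <= 2 ^ m.
Proof.
set b := log_size n; have b1 : 0 < b by [].
have nb : n <= 2 ^ b by rewrite ltnW // lt_log_size.
have bb : b <= 2 ^ b by rewrite ltnW // ltn_expl.
have eb : e <= 2 ^ e by rewrite ltnW // ltn_expl.
apply: (@leq_trans ((2 ^ b) ^ e.-1 * (2 ^ 4 * (2 ^ e * 2 ^ b) * 2 ^ b * (2 ^ 2 * 2 ^ b) *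
   (2 ^ b * 2 ^ b) * (2 ^ b * 2 ^ b)))).
  apply: leq_mul; first by case: (e.-1) => [|q] //; rewrite leq_exp2r.
  have M4 : M <= 2 ^ 2 * 2 ^ b by rewrite /num_levels -/b; move: (2 ^ b) bb => y; lia.
  by rewrite !leq_mul.
rewrite -expnM -!expnD leq_exp2l // /field_log -/b; nia.
Qed.

(** An unfinished run and a bad field element each have probability at most n^(1-e). The set depends
    on the query only through s and Fs. *)
Lemma card_failures : #|failures| * n ^ (e - 2) <= #|{: L.-tuple smp * GF m}|.
Proof.
set qb := query_base J s Fs; set qH := query_H J Fs; set qK := query_K J s.
pose run (t : seq smp) := foldl (ideal_step qb qH qK (J_nm J)) set0 t.
pose X := #|[set t : L.-tuple smp | alive qb qH qK (run t) != set0]|.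
pose T := #|{: L.-tuple smp}|.
have TE : T = #|{: smp}| ^ L by rewrite /T card_tuple.
have [rk fo] := J_forest ok.
have H_sym : symmetric (J_H J) by move=> u v; rewrite /J_H /= (ok_sym ok).
have nm_sym u v : J_nm J (u, v) = J_nm J (v, u) by rewrite /J_nm /= setUC.
have nm_inj u v y z : J_nm J (u, v) = J_nm J (y, z) -> (y, z) = (u, v) \/ (y, z) = (v, u).
  by case/set2_eq => /= -[e1 e2]; [left|right];
    rewrite -[y](ok_vtxK ok) -[z](ok_vtxK ok) e1 e2 !(ok_vtxK ok).
have qH_sym : symmetric qH by move=> u v; rewrite /qH /query_H /= H_sym nm_sym.
have qH_K u v : qH u v -> (u \in qK) = (v \in qK).
  by case/andP=> /(edge_rt fo) uv _; rewrite !inE uv.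
have nm_cut (B : {set 'I_n}) : {in edge_cut qH B &, injective (J_nm J)}.
  move=> [u v] [y z]; rewrite !inE /= => /and3P[uB vB _] /and3P[yB zB _].
  by case/nm_inj=> [-> //|[yv _]]; rewrite yv (negbTE vB) in yB.
have card_n : #|'I_n| * #|'I_n| < 2 ^ M.-1 by rewrite card_ord card_levels.
have sm0 : sound qH qK set0 by move=> uv; rewrite inE.
(* Markov's inequality: a run that fails leaves at least one alive block, and at most n blocks exist
   at the start. *)
have XT : 2 ^ (e * log_size n) * X <= T * n.
  apply: (decay_cancel _ pow_15_16) => //.
  have le : 16 ^ L * \sum_(t : L.-tuple smp) #|alive qb qH qK (run t)| <=
      15 ^ L * T * #|alive qb qH qK set0|.
    rewrite TE; apply: (alive_run _ _ qH_sym qH_K nm_cut card_n L sm0); first exact: same_sym.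
    by move=> u v; exact: same_K.
  apply: (@leq_trans (16 ^ L * \sum_(t : L.-tuple smp) #|alive qb qH qK (run t)|)).
    rewrite leq_mul2l; apply/orP; right; rewrite /X -sum1_card big_mkcond /=.
    by apply: leq_sum => t _; rewrite inE; case: ifP => //; rewrite card_gt0.
  apply: leq_trans le _; rewrite -mulnA !leq_mul2l; apply/orP; right; apply/orP; right.
  apply: leq_trans (subset_leq_card (_ : _ \subset block qb set0 @: qK)) _.
    by apply/subsetP=> B; rewrite inE => /andP[].
  by apply: leq_trans (leq_imset_card _ _) _; rewrite (leq_trans (max_card _)) // card_ord.
pose Y := L * n * M * (n * n) * (n * n).
have leF : #|failures| <= X * 2 ^ m.+1 + T * Y.
  pose F1 := [set om : L.-tuple smp * GF m | alive qb qH qK (run om.1) != set0].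
  pose F2 := [set om : L.-tuple smp * GF m |
    `[< bad_seed qb qH qK (J_nm J) om.1 w0 (edge_tag om.2) >]].
  have -> : failures = F1 :|: F2 by apply/setP=> om; rewrite !inE.
  apply: leq_trans (leq_card_setU _ _) _; apply: leq_add.
    rewrite -(card_GF m) -(cardsT (GF m)) -cardsX; apply: subset_leq_card.
    by apply/subsetP=> -[t x]; rewrite !inE /= => ->.
  rewrite -sum1_card (eq_bigl (fun q : L.-tuple smp * GF m => xpredT q.1 && ((q.1, q.2) \in F2)));
    last by case.
  rewrite -(pair_big_dep xpredT (fun t x => (t, x) \in F2) (fun _ _ => 1)) /=.
  rewrite /T -sum_nat_const; apply: leq_sum => t _; rewrite sum1_card.
  have := @few_bad_seeds n (GF m) _ M L qb qH qK (J_nm J) t w0; apply: leq_trans.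
  by apply: subset_leq_card; apply/subsetP=> x xF; have : (t, x) \in F2 by []; rewrite !inE.
have nb : n ^ e <= 2 ^ (e * log_size n).
  by rewrite mulnC expnM leq_exp2r ?(ltnW e_gt1) // ltnW // lt_log_size.
have Xe : n ^ e.-1 * X <= T.
  rewrite -(@leq_pmul2l n) ?(ltnW n_gt1) // mulnA -expnS prednK ?(ltnW e_gt1) //.
  by rewrite (leq_trans _ (leq_trans XT _)) ?leq_mul2r ?nb ?orbT // mulnC.
(* The sum of the two probabilities costs a factor 2 <= n, hence the exponent e - 2. *)
have main : n * (#|failures| * n ^ (e - 2)) <= n * #|{: L.-tuple smp * GF m}|.
  rewrite mulnCA -expnS (_ : (e - 2).+1 = e.-1); last by lia.
  rewrite card_prod -/T card_GF; apply: leq_trans (leq_mul leF (leqnn _)) _.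
  have sb := seed_bound; rewrite -/Y in sb.
  rewrite mulnDl; apply: (@leq_trans (T * 2 ^ m.+1 + T * 2 ^ m.+1)).
    apply: leq_add; first by rewrite mulnAC leq_mul2r mulnC Xe orbT.
    rewrite -mulnA leq_mul2l mulnC (leq_trans sb) ?orbT // leq_exp2l //.
  by rewrite addnn -mul2n leq_mul2r n_gt1 orbT.
by move: main; rewrite leq_pmul2l // ltnW.
Qed.

End Failure.

(** * Label length *)

Section UniformProbability.
Variables (R : realType) (Om : finType) (om0 : Om).

Let Om_gt0 : 0 < #|Om|%:R :> R.
Proof. by rewrite ltr0n; apply/card_gt0P; exists om0. Qed.

Lemma uniform_ge0 (x : Om) : 0 <= #|Om|%:R^-1 :> R.
Proof. by rewrite invr_ge0 ltW. Qed.

Lemma uniform_sum1 : \sum_(x : Om) #|Om|%:R^-1 = 1 :> R.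
Proof. by rewrite sumr_const -[LHS]mulr_natl divff // gt_eqF. Qed.

Definition uniform : fin_prob R Om := FinProb uniform_ge0 uniform_sum1.

Lemma uniform_prob (A : pred Om) (B : {set Om}) : (forall x, x \notin B -> A x) ->
  1 - #|B|%:R / #|Om|%:R <= Prob uniform A.
Proof.
move=> BA; have <- : \sum_(x in B) #|Om|%:R^-1 = #|B|%:R / #|Om|%:R :> R.
  by rewrite sumr_const -[LHS]mulr_natl.
rewrite -[X in X - _]uniform_sum1 (bigID (mem B)) /= addrAC subrr add0r /Prob /=.
rewrite big_mkcond [X in _ <= X]big_mkcond /=; apply: ler_sum => x _.
by case: (boolP (x \in B)) => [_|/BA ->] //=; case: (A x) => //; exact: uniform_ge0.
Qed.

End UniformProbability.

(** * Logarithms and numeric constants *)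

Section LengthBound.

(** This is ln(1 + y) <= y at y = -1/2. *)
Lemma ln2_ge_half (R : realType) : 2^-1 <= ln 2 :> R.
Proof.
have := @le_ln1Dx R (- 2^-1); move=> /(_ _)/wrap[]; first by lra.
by rewrite (_ : 1 - 2^-1 = 2^-1) ?lnV ?posrE //; lra.
Qed.

Lemma log_size_ln (R : realType) n : (1 < n)%N -> (log_size n)%:R <= 4 * ln n%:R :> R.
Proof.
move=> n1; have n0 : (0 < n)%N by lia.
have h2 := ln2_ge_half R.
have l2 : ln 2 <= ln n%:R :> R by rewrite ler_ln ?posrE ?ltr0n // ler_nat.
have : (trunc_log 2 n)%:R * ln 2 <= ln n%:R :> R.
  rewrite mulr_natl -lnXn // ler_ln ?posrE ?exprn_gt0 ?ltr0n //.
  by rewrite -natrX ler_nat trunc_logP.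
have t0 : 0 <= (trunc_log 2 n)%:R :> R by [].
rewrite /log_size -natr1; nra.
Qed.

(** The least such S is at most 2 + ln x / ln 2 <= 2 + 2 ln x, and 1 <= 2 ln x. *)
Lemma num_scales (R : realType) (x : R) : 2 <= x ->
  exists S : nat, [/\ (0 < S)%N, 2 * x <= 2 ^+ S & S%:R <= 6 * ln x].
Proof.
move=> x2; have ex : exists S, 2 * x <= 2 ^+ S.
  by exists (Num.bound (2 * x)); rewrite ltW //; exact: upper_nthrootP.
pose S := ex_minn ex.
have [hS Smin] : 2 * x <= 2 ^+ S /\ forall j, 2 * x <= 2 ^+ j -> (S <= j)%N.
  by rewrite /S; case: ex_minnP.
have h2 := ln2_ge_half R; have lx : ln 2 <= ln x by rewrite ler_ln ?posrE //; lra.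
have S0 : (0 < S)%N by rewrite lt0n; apply/eqP => S0; move: hS; rewrite S0 expr0; lra.
exists S; split=> //; move: S0 hS Smin; case: (S) => // j _ hj jmin.
have lt : 2 ^+ j <= 2 * x by rewrite ltW // ltNge; apply/negP => /jmin; rewrite ltnn.
have : j%:R * ln 2 <= ln 2 + ln x.
  rewrite mulr_natl -lnXn // -lnM ?posrE //; last by lra.
  by rewrite ler_ln ?posrE ?exprn_gt0 //; lra.
have j0 : 0 <= j%:R :> R by [].
rewrite -natr1; nra.
Qed.

Definition entry_const (e : nat) : nat := 4 + 10 * ((2 * e + 21) * (16 * e + 1)).

Lemma entry_bits_le e n : (entry_bits e n <= entry_const e * log_size n ^ 3)%N.
Proof.
rewrite /entry_bits /field_log /num_rounds /num_levels /entry_const.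
have : (0 < log_size n)%N by []; move: (log_size n) => b b0.
have h1 : (((2 * e + 20) * b).+1 <= (2 * e + 21) * b)%N by nia.
have h2 : ((16 * (e * b)).+1 <= (16 * e + 1) * b)%N by nia.
have h3 : ((2 * b + 2).+1 <= 5 * b)%N by lia.
have h4 := leq_mul h1 (leq_mul h2 h3).
have h5 : (b <= b ^ 3)%N by rewrite -{1}[b]expn1 leq_pexp2l.
rewrite [X in (_ <= X)%N]mulnDl; apply: leq_add; first by rewrite leq_mul2l h5.
apply: (@leq_trans (2 * ((2 * e + 21) * b * ((16 * e + 1) * b * (5 * b))))).
  by rewrite leq_mul2l h4.
by apply: eq_leq; ring.
Qed.

Lemma label_bits_le e n k S Pm : (0 < S)%N -> (0 < Pm)%N -> (k <= Pm)%N ->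
  (4 * log_size n + 2 * k + 4 + 2 * (S * (2 * (Pm * (2 * entry_bits e n).+1)).+1)
   <= (16 + 8 * entry_const e) * (S * Pm * log_size n ^ 3))%N.
Proof.
move=> S0 P0 kP; have := entry_bits_le e n.
have : (0 < log_size n)%N by []; move: (log_size n) (entry_bits e n) (entry_const e) => b B c b0 Bc.
have b3 : (b <= b ^ 3)%N by rewrite -{1}[b]expn1 leq_pexp2l.
have b30 : (0 < b ^ 3)%N by rewrite expn_gt0 b0.
move: (b ^ 3)%N b3 b30 Bc => z bz z0 Bc.
have SP : (0 < S * Pm)%N by rewrite muln_gt0 S0.
have PS : (Pm <= S * Pm)%N by rewrite leq_pmull.
have SS : (S <= S * Pm)%N by rewrite leq_pmulr.
have -> : (2 * (S * (2 * (Pm * (2 * B).+1)).+1) = 8 * (S * Pm * B) + 4 * (S * Pm) + 2 * S)%N.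
  by ring.
move: (S * Pm)%N SP PS SS => q q0 Pq Sq.
have h1 : (q * B <= q * (c * z))%N by rewrite leq_mul2l Bc orbT.
have h2 : (b <= q * z)%N by rewrite (leq_trans bz) // leq_pmull.
have h3 : (q <= q * z)%N by rewrite leq_pmulr.
have -> : ((16 + 8 * c) * (q * z) = 16 * (q * z) + 8 * (q * (c * z)))%N by ring.
move: (q * B)%N (q * (c * z))%N (q * z)%N h1 h2 h3 => x y w h1 h2 h3; lia.
Qed.

End LengthBound.

(** * The labeling scheme *)

(** With at most one vertex ln n is 0, so the length bound forces empty labels; these are equal, and
    the decoder answers 0. *)
Lemma small_graph_scheme (R : realType) (V : finType) (G : wgraph R V) (e f : nat)
    (stretch : nat -> R) (len err : R) :
  (forall x, x \in edges G -> 1 <= weight G x) ->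
  (#|V| <= 1)%N -> len = 0 -> 0 <= err ->
  randomized_FT_distance_labeling G (dist_dec R e) f stretch len err.
Proof.
move=> w1 V1 -> err0.
exists unit, (uniform R tt), (fun=> Labeling (fun=> [::]) (fun=> [::])); split.
  by move=> _; rewrite /label_length !big1.
move=> s t F Fs _ _ _; have -> : t = s by apply: (card_le1_eqP V1).
apply: (@le_trans _ _ (1 - #|@set0 unit|%:R / #|{: unit}|%:R)).
  by rewrite cards0 mul0r subr0 lerBlDr lerDl.
apply: uniform_prob => x _; rewrite /good_estimate /dist_dec /= (dist_refl w1) mule0.
by rewrite lexx.
Qed.

Lemma large_graph_scheme (R : realType) (V : finType) (G : wgraph R V) (e f k : nat) (W : R) :
  (1 < e)%N -> (1 < #|V|)%N -> (0 < k)%N -> 1 <= W ->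
  (forall x, x \in edges G -> 1 <= weight G x <= W) ->
  randomized_FT_distance_labeling G (dist_dec R (e + 5)) f
    (fun m : nat => (8 * k%:R - 2) * (m%:R + 1))
    ((384 * (16 + 8 * entry_const (e + 5)))%:R *
       (k%:R * #|V|%:R `^ (k%:R^-1) * ln (#|V|%:R * W) * ln #|V|%:R ^+ 3))
    (1 / #|V|%:R ^+ (e - 2)).
Proof.
move=> e1 V1 k0 W1 wW.
have w1 x : x \in edges G -> 1 <= weight G x by case/wW/andP.
have n2 : 2 <= #|V|%:R :> R by rewrite (ler_nat R 2).
have nW2 : 2 <= #|V|%:R * W by nra.
have [S [S0 hS lS]] := num_scales nW2.
have exJ i : exists PJ : nat * (nat -> instance V), [/\
    PJ.1%:R <= k%:R * kroot R k #|V|, (PJ.1 <= #|V|)%N,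
    forall p, (p < PJ.1)%N -> instance_ok (PJ.2 p),
    forall p F s t, (p < PJ.1)%N -> connect (survive (PJ.2 p) F) s t ->
      near G (adj_minus G F) ((4 * k%:R - 1) * (#|F|%:R + 1) * 2 ^+ i) s t &
    forall s, exists2 p, (p < PJ.1)%N & forall F t, near G (adj_minus G F) (2 ^+ i) s t ->
      connect (survive (PJ.2 p) F) s t].
  have [|P [J H]] := @scale_instances R V G k w1 k0 (2 ^+ i); first by rewrite exprn_ge0.
  by exists (P, J).
have [PJ PJP] := choice exJ.
(* An irrelevant scale stores no phase, so it makes no claim and cannot fail. *)
pose J i := (PJ i).2; pose P i := if relevant G i then (PJ i).1 else 0%N.
have PP i : (P i <= (PJ i).1)%N by rewrite /P; case: ifP.
have Pn i : (P i <= #|V|)%N by apply: leq_trans (PP i) _; have [] := PJP i.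
have Jok i p : (p < P i)%N -> instance_ok (J i p).
  by move=> pP; have [_ _ ok _ _] := PJP i; apply: ok; exact: leq_trans pP (PP i).
have relS i : relevant G i -> (i < S)%N.
  case/existsP=> ab /andP[/wW/andP[_ wle] /andP[_ lt]].
  rewrite -(@ltr_eXn2l R 2) ?ltr1n //; apply: lt_le_trans lt (le_trans _ hS).
  by rewrite mulrA ler_wpM2l // mulr_ge0.
pose e' := (e + 5)%N; pose L := num_rounds e' #|V|; pose M := num_levels #|V|.
pose smp := {ffun {set V} -> 'I_(2 ^ M)}.
have pw0 : (0 < 2 ^ M)%N by rewrite expn_gt0.
pose w0 : smp := [ffun=> Ordinal pw0].
pose Om : finType := (L.-tuple smp * GF (field_log e' #|V|))%type.
pose om0 : Om := (nseq_tuple L w0, 0).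
exists Om, (uniform R om0), (fun om => Labeling (vert_label (e := e') S P J k om)
  (edge_label (e := e') S P J w0 om)); split.
  move=> om.
  set kk := k%:R * #|V|%:R `^ (k%:R^-1) : R.
  have r1 : 1 <= kroot R k #|V| by apply: kroot_ge1 => //; exact: ltnW.
  have k1 : 1 <= k%:R :> R by rewrite ler1n.
  have kkE : kk = k%:R * kroot R k #|V| by [].
  have kk1 : k%:R <= kk by rewrite kkE ler_peMr.
  pose Pm := Num.truncn kk.
  have /andP[Pmk ltPm] : Pm%:R <= kk < Pm.+1%:R by apply: truncn_itv; exact: le_trans kk1.
  have lePm (j : nat) : j%:R <= kk -> (j <= Pm)%N.
    by move=> le; rewrite -ltnS -(ltr_nat R); exact: le_lt_trans ltPm.
  have kPm : (k <= Pm)%N by exact: lePm.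
  have Pm0 : (0 < Pm)%N by exact: leq_trans k0 kPm.
  have PPm i : (i < S)%N -> (P i <= Pm)%N.
    move=> _; apply: lePm; apply: (@le_trans _ _ (PJ i).1%:R); first by rewrite ler_nat.
    by rewrite kkE; have [] := PJP i.
  set N := ((16 + 8 * entry_const e') * (S * Pm * log_size #|V| ^ 3))%N.
  have leN : (label_length G (Labeling (vert_label (e := e') S P J k om)
      (edge_label (e := e') S P J w0 om)) <= N)%N.
    have lb := @label_bits_le e' #|V| k S Pm S0 Pm0 kPm.
    rewrite /label_length geq_max; apply/andP; split; apply/bigmax_leqP => x _ /=.
      exact: leq_trans (size_vert_label _ _ _ _ PPm) lb.
    apply: leq_trans (size_edge_label _ _ _ _ PPm) (leq_trans _ lb).
    by apply: leq_trans (leq_addl _ _); exact: leq_pmull.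
  apply: (@le_trans _ _ N%:R); first by rewrite ler_nat.
  have lb := log_size_ln R V1; have h2 := ln2_ge_half R.
  have ln1 : 0 <= ln #|V|%:R :> R by rewrite ln_ge0 // (le_trans _ n2) // ler1n.
  have lnW : 0 <= ln (#|V|%:R * W) :> R by rewrite ln_ge0 // (le_trans _ nW2) // ler1n.
  rewrite /N natrM [(384 * _)%N]mulnC [(_ * 384)%:R]natrM -[X in _ <= X]mulrA ler_wpM2l //.
  rewrite natrM natrX natrM -/kk.
  (* The constant 384 is 6 for the scales times 4^3 for the three factors [log_size]. *)
  apply: (@le_trans _ _ (6 * ln (#|V|%:R * W) * kk * (4 * ln #|V|%:R) ^+ 3)).
    apply: ler_pM; rewrite ?mulr_ge0 ?exprn_ge0 //; first by apply: ler_pM.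
    by rewrite lerXn2r // nnegrE // mulr_ge0.
  by rewrite le_eqVlt; apply/orP; left; apply/eqP; ring.
move=> s t F Fs FE _ Fperm.
have FsF f' : (f' \in Fs) = (f' \in F) by rewrite (perm_mem Fperm) mem_enum.
have F2 f' : f' \in F -> #|f'| = 2%N by move=> /(subsetP FE)/edges_card2.
pose B : {set Om} := \bigcup_(q : 'I_S * 'I_#|V| | (q.2 < P q.1)%N)
  @failures V e' (J q.1 q.2) s Fs w0.
have cB : (#|B| * #|V| ^ (e - 2) <= #|Om|)%N.
  have V0 : (0 < #|V| ^ 5)%N by rewrite expn_gt0 ltnW.
  rewrite -(@leq_pmul2l (#|V| ^ 5)) // mulnCA -expnD.
  have -> : (5 + (e - 2) = e' - 2)%N by rewrite /e'; lia.
  (* At most n^2 (log n + 1) relevant scales with at most n phases each; the resulting n^5 is why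
     the labels are built for e + 5. *)
  have cQ : (#|[pred q : 'I_S * 'I_#|V| | (q.2 < P q.1)%N]| <= #|V| ^ 5)%N.
    pose rel := [set i : 'I_S | relevant G i].
    apply: (@leq_trans #|setX rel [set: 'I_#|V|]|).
      apply: subset_leq_card; apply/subsetP=> -[i p]; rewrite !inE /= andbT /P.
      by case: ifP.
    rewrite cardsX cardsT card_ord.
    apply: leq_trans (leq_mul (card_relevant w1 k0 S) (leqnn _)) _.
    have := log_size_le V1; move: (log_size #|V|) => b bn.
    rewrite -!mulnA !expnS expn0 muln1 !leq_mul2l; apply/orP; right; apply/orP; right.
    by nia.
  apply: (@leq_trans (\sum_(q : 'I_S * 'I_#|V| | (q.2 < P q.1)%N) #|Om|)); last first.
    by rewrite sum_nat_const leq_mul2r cQ orbT.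
  apply: (@leq_trans ((\sum_(q : 'I_S * 'I_#|V| | (q.2 < P q.1)%N)
      #|@failures V e' (J q.1 q.2) s Fs w0|) * #|V| ^ (e' - 2))).
    rewrite leq_mul2r; apply/orP; right; rewrite /B.
    elim/big_ind2: _ => [|X a Y b le1 le2|//]; first by rewrite cards0.
    by apply: leq_trans (leq_add le1 le2); rewrite -cardsUI leq_addr.
  rewrite big_distrl /=; apply: leq_sum => q qP.
  by apply: card_failures => //; [exact: Jok|rewrite /e'; lia].
apply: (@le_trans _ _ (1 - #|B|%:R / #|Om|%:R)).
  rewrite lerD2l lerN2 mul1r -natrX.
  have Vp : 0 < (#|V| ^ (e - 2))%:R :> R by rewrite ltr0n expn_gt0 ltnW.
  have Op : 0 < #|Om|%:R :> R by rewrite ltr0n; apply/card_gt0P; exists om0.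
  by rewrite ler_pdivrMr // mulrC ler_pdivlMr // -natrM ler_nat.
apply: uniform_prob => om omB /=; rewrite dist_decE.
have [<-|st] := eqVneq s t.
  by rewrite /good_estimate (dist_refl w1) mule0 lexx.
have claimE i p : (i < S)%N -> (p < P i)%N ->
    claim e' #|V| (vert_body S P J om s) (vert_body S P J om t)
      (map (edge_label S P J w0 om) Fs) i p = connect (survive (J i p) F) s t.
  move=> iS pP; rewrite claim_labels //; last by move=> f'; rewrite FsF => /F2.
  have nF : om \notin @failures V e' (J i p) s Fs w0.
    apply: contra omB => omF; apply/bigcupP.
    by exists (Ordinal iS, Ordinal (leq_trans pP (Pn i))).
  move: nF; rewrite inE negb_or negbK => /andP[/eqP al0 /asboolPn nbad].
  exact: (conn_codes_correct (Jok _ _ pP) _ Fperm F2 nbad al0).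
have -> : size Fs = #|F| by rewrite (perm_size Fperm) cardE.
apply: (@estimate_correct R V G k w1 k0 S P J) => //.
- move=> i p F' u v pP; have [_ _ _ snd _] := PJP i; apply: snd.
  exact: leq_trans pP (PP i).
- move=> i u ri; have [_ _ _ _ cvr] := PJP i; have [p pP pc] := cvr u.
  by exists p => //; rewrite /P ri.
- by rewrite size_map size_iota.
- move=> i iS; rewrite (nth_map 0%N) ?size_iota // nth_iota // add0n.
  by apply: eq_in_has => p; rewrite mem_iota add0n => pP; exact: claimE.
Qed.

Theorem theorem1p2 (R : realType) (c : R) (c_gt0 : 0 < c) :
  exists (C : R) (dec : decoder R),
    forall (n : nat) (V : finType) (G : wgraph R V) (W : R) (f k : nat),
      #|V| = n ->
      1 <= W ->
      (forall e, e \in edges G -> 1 <= weight G e <= W) ->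
      (1 <= f)%N ->
      (1 <= k)%N ->
      randomized_FT_distance_labeling G dec f
        (fun m : nat => (8 * k%:R - 2) * (m%:R + 1))
        (C * (k%:R * n%:R `^ (k%:R^-1) * ln (n%:R * W) * ln n%:R ^+ 3))
        (1 / n%:R `^ c).
Proof.
(* Then e - 2 is at least c, and 1 < e. *)
pose e := (Num.bound c + 2)%N.
exists ((384 * (16 + 8 * entry_const (e + 5)))%:R), (dist_dec R (e + 5)).
move=> n V G W f k <- W1 wW _ k0; have [V1|V1] := leqP #|V| 1.
  apply: small_graph_scheme => //.
  - by move=> x /wW/andP[].
  - have -> : ln #|V|%:R = 0 :> R.
      by move: V1; case: #|V| => [|[|//]] _; [exact: ln0|exact: ln1].
    by rewrite expr0n /= !mulr0.
have e1 : (1 < e)%N by rewrite /e addn2.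
have [Om [P [L [len prob]]]] := @large_graph_scheme R V G e f k W e1 V1 k0 W1 wW.
exists Om, P, L; split=> // s t F Fs FE Ff Fperm.
apply: le_trans (prob s t F Fs FE Ff Fperm); rewrite lerD2l lerN2.
have V1' : 1 <= #|V|%:R :> R by rewrite ler1n ltnW.
rewrite ler_pM2l // lef_pV2 ?posrE ?powR_gt0 ?exprn_gt0 //; try lra.
rewrite -powR_mulrn; last by lra.
by apply: ler_powR => //; rewrite /e addnK ltW // archi_boundP // ltW.
Qed.
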